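(* Let $A\in 2^\omega$ and suppose that one of the following holds: (a) $A\geq_{\omega_1^{ck}T}O$; (b) $A$ is tree-collapsing; or (c) $A$ is higher ML-random. Then there is a universal higher $A$-ML-test.
   Context: For $A\in 2^\omega$ and $W\subseteq 2^{<\omega}\times 2^{<\omega}$ let $W^A=\{\sigma : (\exists \tau\prec A)\ (\tau,\sigma)\in W\}$, where $\tau\prec A$ means that $\tau$ is a finite initial segment of $A$. For $V\subseteq 2^{<\omega}$ let $[V]^\prec=\{X\in 2^\omega : (\exists\sigma\prec X)\ \sigma\in V\}$. A sequence $\langle \mathcal{U}_n\rangle_{n<\omega}$ of subsets of $2^\omega$ is uniformly higher $A$-c.e. open if there is a single $\Pi^1_1$ (lightface, no oracle) set $W\subseteq\omega\times 2^{<\omega}\times 2^{<\omega}$ with $\mathcal{U}_n=[W_n^A]^\prec$ for all $n$, where $W_n=\{(\tau,\sigma):(n,\tau,\sigma)\in W\}$. $\lambda$ is the fair-coin measure on $2^\omega$. A higher $A$-ML-test is a uniformly higher $A$-c.e. open sequence $\langle\mathcal{U}_n\rangle$ with $\lambda(\mathcal{U}_n)\leq 2^{-n}$ for all $n$. $X$ is higher $A$-ML-random if $X\notin\bigcap_n\mathcal{U}_n$ for every higher $A$-ML-test. A higher $A$-ML-test $\langle\mathcal{V}_n\rangle$ is universal if $\bigcap_n\mathcal{V}_n$ contains every sequence that is not higher $A$-ML-random. Higher ML-tests and higher ML-randomness are the unrelativised notions: the test is given by a single $\Pi^1_1$ set $U\subseteq\omega\times 2^{<\omega}$ via $\mathcal{U}_n=[\{\sigma:(n,\sigma)\in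 U\}]^\prec$. $O$ is Kleene's $O$ (a complete $\Pi^1_1$ set of natural numbers). A higher Turing functional is a $\Pi^1_1$ set $\Phi\subseteq 2^{<\omega}\times 2^{<\omega}$; $\Phi(X)=Y$ means that the strings $\sigma$ such that $(\tau,\sigma)\in\Phi$ for some $\tau\prec X$ are pairwise comparable and their union is $Y$. $X\geq_{\omega_1^{ck}T}Y$ means that $\Phi(X)=Y$ for some higher Turing functional $\Phi$. $A$ is tree-collapsing if there is a $\Pi^1_1$ tree $T\subseteq 2^{<\omega}$ (a set closed under initial segments) such that $A\in[T]$ (all finite initial segments of $A$ are in $T$), but for every $\Delta^1_1$ subtree $S\subseteq T$, $A\notin[S]$. *)

(* Defs.v *)
From Stdlib Require Cantor.
From mathcomp Require Import all_boot all_order all_algebra.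
From mathcomp Require Import boolp classical_sets reals constructive_ereal ereal esum.

Set Implicit Arguments.
Unset Strict Implicit.
Unset Printing Implicit Defensive.

Import Order.TTheory GRing.Theory Num.Theory.

Local Open Scope classical_set_scope.
Local Open Scope nat_scope.

Notation string := (seq bool).
Notation cantor := (nat -> bool).

Definition initial (s : string) (X : cantor) : Prop := s = mkseq X (size s).

Definition open_of (V : set string) : set cantor :=
  [set X | exists2 s, initial s X & V s].

Definition section (W : set (string * string)) (A : cantor) : set string :=
  [set s | exists2 t, initial t A & W (t, s)].

(** * Pi^1_1 and Delta^1_1 sets

    The language of arithmetic with one additional unary function symbol
    [App]; number variables are de Bruijn indices. *)

Inductive term : Type :=
| Var of nat
| Zero
| Succ of term
| Add of term & term
| Mul of term & term
| App of term.

Inductive formula : Type :=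
| Eq of term & term
| Not of formula
| And of formula & formula
| All of formula.

Fixpoint teval (f : nat -> nat) (e : seq nat) (t : term) : nat :=
  match t with
  | Var i => nth 0 e i
  | Zero => 0
  | Succ t => (teval f e t).+1
  | Add t u => teval f e t + teval f e u
  | Mul t u => teval f e t * teval f e u
  | App t => f (teval f e t)
  end.

Fixpoint holds (f : nat -> nat) (e : seq nat) (p : formula) : Prop :=
  match p with
  | Eq t u => teval f e t = teval f e u
  | Not p => ~ holds f e p
  | And p q => holds f e p /\ holds f e q
  | All p => forall n, holds f (n :: e) p
  end.

(** Lightface: the only parameters are the numbers [code x] that represent
    the argument [x]. *)
Definition Pi11 (T : Type) (code : T -> seq nat) (P : set T) : Prop :=
  exists p : formula, forall x, P x <-> forall f, holds f (code x) p.

Definition Delta11 (T : Type) (code : T -> seq nat) (P : set T) : Prop :=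
  Pi11 code P /\ Pi11 code (~` P).

(** Bijective base-2 numeration, an effective bijection of 2^{<omega} with
    omega. *)
Fixpoint scode (s : string) : nat :=
  if s is b :: s' then (scode s').*2 + b + 1 else 0.

Definition code_s (s : string) : seq nat := [:: scode s].

Definition code_ns (x : nat * string) : seq nat := [:: x.1; scode x.2].

Definition code_ss (x : string * string) : seq nat :=
  [:: scode x.1; scode x.2].

Definition code_nss (x : nat * string * string) : seq nat :=
  [:: x.1.1; scode x.1.2; scode x.2].

(** * Kleene's O

    Unary partial recursive functions, with tuples handled by the Cantor
    pairing. [run c] is the graph of the function computed by [c]. *)

Definition pair_nat (x y : nat) : nat := Cantor.to_nat (x, y).

Inductive prog : Type :=
| PZero
| PSucc
| PFst
| PSnd
| PPair of prog & prog
| PComp of prog & prog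
| PRec of prog & prog
| PMu of prog.

Fixpoint run (c : prog) (x y : nat) : Prop :=
  match c with
  | PZero => y = 0
  | PSucc => y = x.+1
  | PFst => y = (Cantor.of_nat x).1
  | PSnd => y = (Cantor.of_nat x).2
  | PPair c d => exists a b, [/\ run c x a, run d x b & y = pair_nat a b]
  | PComp c d => exists2 z, run d x z & run c z y
  | PRec c d =>
      (* [h i] is the value at [pair_nat a i], for [i <= n] *)
      let: (a, n) := Cantor.of_nat x in
      exists h : nat -> nat,
        [/\ run c a (h 0),
            forall i, i < n -> run d (pair_nat a (pair_nat i (h i))) (h i.+1)
          & y = h n]
  | PMu c =>
      run c (pair_nat x y) 0 /\
      forall m, m < y -> exists k, run c (pair_nat x m) k.+1
  end.

Fixpoint godel (c : prog) : nat :=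
  match c with
  | PZero => 0
  | PSucc => 1
  | PFst => 2
  | PSnd => 3
  | PPair c d => 4 * pair_nat (godel c) (godel d) + 4
  | PComp c d => 4 * pair_nat (godel c) (godel d) + 5
  | PRec c d => 4 * pair_nat (godel c) (godel d) + 6
  | PMu c => 4 * godel c + 7
  end.

Definition phi (e x y : nat) : Prop := exists2 c, godel c = e & run c x y.

Inductive kleeneO : nat -> Prop :=
| O_zero : kleeneO 1
| O_succ a : kleeneO a -> kleeneO (2 ^ a)
| O_lim e (g : nat -> nat) :
    (forall n, phi e n (g n)) ->
    (forall n, kleeneO (g n)) ->
    (forall n, ltO (g n) (g n.+1)) ->
    kleeneO (3 * 5 ^ e)
with ltO : nat -> nat -> Prop :=
| ltO_succ a : kleeneO a -> ltO a (2 ^ a)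
| ltO_lim e (g : nat -> nat) n :
    (forall n, phi e n (g n)) ->
    (forall n, kleeneO (g n)) ->
    (forall n, ltO (g n) (g n.+1)) ->
    ltO (g n) (3 * 5 ^ e)
| ltO_trans a b c : ltO a b -> ltO b c -> ltO a c.

Definition seqO : cantor := fun n => `[< kleeneO n >].

(** * Higher Turing reducibility and tree-collapsing sequences *)

(** The last conjunct says that the union of the strings in [section F X],
    as finite partial functions, is [Y]. *)
Definition maps_to (F : set (string * string)) (X Y : cantor) : Prop :=
  (forall s s', section F X s -> section F X s' ->
     prefix s s' || prefix s' s) /\
  (forall i b, Y i = b <->
     exists2 s, section F X s & i < size s /\ nth false s i = b).

Definition higher_computes (X Y : cantor) : Prop :=
  exists2 F : set (string * string), Pi11 code_ss F & maps_to F X Y.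

Definition is_tree (T : set string) : Prop :=
  forall s t, prefix s t -> T t -> T s.

Definition path_of (T : set string) : set cantor :=
  [set X | forall s, initial s X -> T s].

Definition tree_collapsing (A : cantor) : Prop :=
  exists T : set string,
    [/\ is_tree T, Pi11 code_s T, path_of T A &
        forall S : set string,
          is_tree S -> Delta11 code_s S -> S `<=` T -> ~ path_of S A].

(** * Higher randomness *)

(** The outer measure generated by [s] |-> 2^{-|s|} on basic clopen sets; on
    measurable sets, in particular on open ones, it is the fair-coin measure. *)
Definition coin (R : realType) (U : set cantor) : \bar R :=
  ereal_inf
    [set (\esum_(s in V) (2 ^- size s : R)%:E)%R
       | V in [set V | U `<=` open_of V]].

Definition higher_ML_test (R : realType) (U : nat -> set cantor) : Prop :=
  (exists2 W : set (nat * string), Pi11 code_ns W &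
     forall n, U n = open_of [set s | W (n, s)]) /\
  (forall n, (coin R (U n) <= ((2 ^- n)%R : R)%:E)%E).

Definition higher_ML_random (R : realType) (X : cantor) : Prop :=
  forall U, higher_ML_test R U -> ~ (\bigcap_n U n) X.

Definition higher_ce_open (A : cantor) (U : nat -> set cantor) : Prop :=
  exists2 W : set (nat * string * string), Pi11 code_nss W &
    forall n, U n = open_of (section [set ts | W (n, ts.1, ts.2)] A).

Definition higher_ML_test_rel (R : realType) (A : cantor)
    (U : nat -> set cantor) : Prop :=
  higher_ce_open A U /\
  (forall n, (coin R (U n) <= ((2 ^- n)%R : R)%:E)%E).

Definition higher_ML_random_rel (R : realType) (A X : cantor) : Prop :=
  forall U, higher_ML_test_rel R A U -> ~ (\bigcap_n U n) X.

Definition universal_test_rel (R : realType) (A : cantor)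
    (V : nat -> set cantor) : Prop :=
  higher_ML_test_rel R A V /\
  forall X, ~ higher_ML_random_rel R A X -> (\bigcap_n V n) X.

(* Main.v *)
From Stdlib Require Cantor.
Require Import Defs.
From mathcomp Require Import all_boot all_order all_algebra.
From mathcomp Require Import zify finmap.
From mathcomp Require Import boolp classical_sets cardinality fsbigop.
From mathcomp Require Import reals constructive_ereal ereal esum.

(** Proof idea. A test enumerated from the oracle [A] has to be stopped when its
    measure becomes too large, and the decision to continue must be visible in a
    finite initial segment of [A], although the enumeration takes transfinitely
    many stages. Membership in Pi^1_1 sets is reduced to well-foundedness of
    trees; comparing the ranks of these trees gives a Pi^1_1 relation saying
    which of two elements of a universal Pi^1_1 set is enumerated first.

    In the first two cases [A] turns this enumeration into an increasing sequence
    of finite sets, which can be tested for measure one by one. If [A] computes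
    [O], which is complete, it decides longer and longer parts of the universal
    set. If [A] is tree-collapsing via [T], the [n]-th set consists of what is
    enumerated no later than some [A|k], [k <= n], enters [T];
      nothing is missed,
    since a stage bounding the entries of all the [A|k] would yield a Delta^1_1
    subtree of [T] with path [A].

    If [A] is random, then for each element [i] of the universal set the oracles
    for which the part enumerated up to [i] is too large form an open set, which
    is approximated from inside by a clopen set up to an error of measure
    [2 ^- (c + i.+1)]. The errors form a higher ML-test with index [c], so for
    some [c] they avoid [A], and for this [c] the approximations make the right
    decision at [A].

    Calling [Z e m] the trimmed version of the [m]-th component of the [e]-th
    test, the universal test is the union of the [Z e (n + e + 1)] over [e]. *)

Set Implicit Arguments.
Unset Strict Implicit.
Unset Printing Implicit Defensive.

Import Order.TTheory GRing.Theory Num.Theory.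

Local Open Scope nat_scope.

(** * Primitive recursive functions *)

Definition pi1 (z : nat) : nat := (Cantor.of_nat z).1.
Definition pi2 (z : nat) : nat := (Cantor.of_nat z).2.

Lemma pi1_pair x y : pi1 (pair_nat x y) = x.
Proof. by rewrite /pi1 /pair_nat Cantor.cancel_of_to. Qed.

Lemma pi2_pair x y : pi2 (pair_nat x y) = y.
Proof. by rewrite /pi2 /pair_nat Cantor.cancel_of_to. Qed.

Definition pairE := (pi1_pair, pi2_pair).

Lemma pair_pi z : pair_nat (pi1 z) (pi2 z) = z.
Proof.
by rewrite /pair_nat /pi1 /pi2 -surjective_pairing Cantor.cancel_to_of.
Qed.

Lemma pair_inj x y x' y' : pair_nat x y = pair_nat x' y' -> x = x' /\ y = y'.
Proof. by move=> e; rewrite -(pi1_pair x y) -{2}(pi2_pair x y) e !pairE. Qed.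

Lemma pair_spec x y : (pair_nat x y).*2 = y.*2 + (y + x) * (y + x).+1.
Proof.
have := Cantor.to_nat_spec x y; rewrite -/(pair_nat x y); lia.
Qed.

Lemma pair_bound x y : x + y <= pair_nat x y.
Proof. have := pair_spec x y; nia. Qed.

Lemma pi1_le z : pi1 z <= z.
Proof. by have := pair_bound (pi1 z) (pi2 z); rewrite pair_pi; lia. Qed.

Lemma pi2_le z : pi2 z <= z.
Proof. by have := pair_bound (pi1 z) (pi2 z); rewrite pair_pi; lia. Qed.

(** Tuples are packed by the Cantor pairing, as in [prog], so that [run_primrec] is a direct
    induction. Decidable predicates are treated as functions with values 0 and 1, through the
    coercion of booleans. *)
Inductive primrec : (nat -> nat) -> Prop :=
| pr_zero : primrec (fun=> 0)
| pr_succ : primrec S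
| pr_pi1 : primrec pi1
| pr_pi2 : primrec pi2
| pr_pair F G : primrec F -> primrec G ->
    primrec (fun x => pair_nat (F x) (G x))
| pr_comp F G : primrec F -> primrec G -> primrec (fun x => F (G x))
| pr_rec F G : primrec F -> primrec G ->
    primrec (fun x => iteri (pi2 x)
                        (fun i r => G (pair_nat (pi1 x) (pair_nat i r)))
                        (F (pi1 x))).

Lemma pr_ext (F G : nat -> nat) : F =1 G -> primrec F -> primrec G.
Proof. by move=> /funext ->. Qed.

Lemma pr_id : primrec (fun x => x).
Proof. exact: pr_ext pair_pi (pr_pair pr_pi1 pr_pi2). Qed.

Lemma pr_const c : primrec (fun=> c).
Proof.
elim: c => [|c IH]; first exact: pr_zero.
exact: pr_comp pr_succ IH.
Qed.

Lemma pr_S F : primrec F -> primrec (fun x => (F x).+1).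
Proof. exact: pr_comp pr_succ. Qed.

Lemma pr_fst F : primrec F -> primrec (fun x => pi1 (F x)).
Proof. exact: pr_comp pr_pi1. Qed.

Lemma pr_snd F : primrec F -> primrec (fun x => pi2 (F x)).
Proof. exact: pr_comp pr_pi2. Qed.

Lemma pr_iteri N B (G : nat -> nat -> nat -> nat) :
  primrec N -> primrec B ->
  primrec (fun z => G (pi1 z) (pi1 (pi2 z)) (pi2 (pi2 z))) ->
  primrec (fun x => iteri (N x) (G x) (B x)).
Proof.
move=> hN hB hG.
have := pr_comp (pr_rec hB hG) (pr_pair pr_id hN).
apply: pr_ext => x; rewrite !pairE; apply: eq_iteri => i r.
by rewrite !pairE.
Qed.

Lemma pr_app2 (G : nat -> nat -> nat) F1 F2 :
  primrec (fun z => G (pi1 z) (pi2 z)) -> primrec F1 -> primrec F2 ->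
  primrec (fun x => G (F1 x) (F2 x)).
Proof.
move=> hG h1 h2; have := pr_comp hG (pr_pair h1 h2).
by apply: pr_ext => x; rewrite !pairE.
Qed.

Ltac pr_base :=
  lazymatch goal with
  | |- primrec S => exact: pr_succ
  | |- primrec pi1 => exact: pr_pi1
  | |- primrec pi2 => exact: pr_pi2
  | |- primrec (fun x => x) => exact: pr_id
  | |- primrec (fun _ => ?c) => exact: pr_const
  | |- primrec (fun x => pi1 (@?F x)) => apply: (@pr_fst F)
  | |- primrec (fun x => pi2 (@?F x)) => apply: (@pr_snd F)
  | |- primrec (fun x => (@?F x).+1) => apply: (@pr_S F)
  | |- primrec (fun x => pair_nat (@?F x) (@?G x)) => apply: (@pr_pair F G)
  | _ => assumption
  end.

Lemma pr_add F G : primrec F -> primrec G -> primrec (fun x => F x + G x).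
Proof.
move=> hF hG; apply: (@pr_ext (fun x => iteri (G x) (fun _ => S) (F x))).
  by move=> x; elim: (G x) => [|n IH] /=; rewrite ?addn0 // IH addnS.
apply: pr_iteri => //; repeat pr_base.
Qed.

Lemma pr_pred F : primrec F -> primrec (fun x => (F x).-1).
Proof.
move=> hF; apply: (@pr_ext (fun x => iteri (F x) (fun i _ => i) 0)).
  by move=> x; case: (F x).
apply: pr_iteri => //; repeat pr_base.
Qed.

Lemma pr_sub F G : primrec F -> primrec G -> primrec (fun x => F x - G x).
Proof.
move=> hF hG; apply: (@pr_ext (fun x => iteri (G x) (fun _ => predn) (F x))).
  by move=> x; elim: (G x) => [|n IH] /=; rewrite ?subn0 // IH subnS.
apply: pr_iteri => //; apply: pr_pred; repeat pr_base.
Qed.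

Lemma pr_mul F G : primrec F -> primrec G -> primrec (fun x => F x * G x).
Proof.
move=> hF hG.
apply: (@pr_ext (fun x => iteri (G x) (fun _ r => r + F x) 0)).
  by move=> x; elim: (G x) => [|n IH] /=; rewrite ?muln0 // IH mulnSr.
apply: pr_iteri => //; first exact: pr_zero.
apply: pr_add; first by repeat pr_base.
exact: pr_comp hF pr_pi1.
Qed.

Lemma pr_exp F G : primrec F -> primrec G -> primrec (fun x => F x ^ G x).
Proof.
move=> hF hG.
apply: (@pr_ext (fun x => iteri (G x) (fun _ r => r * F x) 1)).
  by move=> x; elim: (G x) => [|n IH] /=; rewrite ?expn0 // IH expnSr.
apply: pr_iteri => //; first exact: pr_const.
apply: pr_mul; first by repeat pr_base.
exact: pr_comp hF pr_pi1.
Qed.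

Lemma pr_odd F : primrec F -> primrec (fun x => odd (F x)).
Proof.
move=> hF; apply: (@pr_ext (fun x => iteri (F x) (fun _ r => 1 - r) 0)).
  by move=> x; elim: (F x) => [|n IH] //=; rewrite IH; case: (odd n).
apply: pr_iteri => //; first exact: pr_const.
apply: pr_sub; repeat pr_base.
Qed.

Lemma pr_half F : primrec F -> primrec (fun x => (F x)./2).
Proof.
move=> hF; apply: (@pr_ext (fun x => iteri (F x) (fun i r => odd i + r) 0)).
  by move=> x; elim: (F x) => [|n IH] //=; rewrite IH uphalf_half.
apply: pr_iteri => //; first exact: pr_const.
apply: pr_add; first apply: pr_odd.
all: repeat pr_base.
Qed.

Lemma pr_leq F G :
  primrec F -> primrec G -> primrec (fun x => F x <= G x : bool).
Proof.
move=> hF hG; apply: (@pr_ext (fun x => 1 - (F x - G x))).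
  by move=> x; rewrite /leq; case: (F x - G x).
by apply: pr_sub; [exact: pr_const | exact: pr_sub].
Qed.

Lemma pr_and (b c : nat -> bool) :
  primrec b -> primrec c -> primrec (fun x => b x && c x).
Proof.
move=> hb hc; apply: pr_ext (pr_mul hb hc) => x.
by case: (b x); case: (c x).
Qed.

Lemma pr_neg (b : nat -> bool) : primrec b -> primrec (fun x => ~~ b x).
Proof.
move=> hb; apply: pr_ext (pr_sub (pr_const 1) hb) => x.
by case: (b x).
Qed.

Lemma pr_or (b c : nat -> bool) :
  primrec b -> primrec c -> primrec (fun x => b x || c x).
Proof.
move=> hb hc; apply: pr_ext (pr_neg (pr_and (pr_neg hb) (pr_neg hc))) => x.
by rewrite negb_and !negbK.
Qed.

Lemma pr_eq F G : primrec F -> primrec G -> primrec (fun x => F x == G x).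
Proof.
move=> hF hG; apply: pr_ext (pr_and (pr_leq hF hG) (pr_leq hG hF)) => x.
by rewrite -eqn_leq.
Qed.

Lemma pr_beq (b c : nat -> bool) :
  primrec b -> primrec c -> primrec (fun x => b x == c x).
Proof.
move=> hb hc; apply: pr_ext (pr_eq hb hc) => x.
by case: (b x); case: (c x).
Qed.

Lemma pr_if (b : nat -> bool) F G : primrec b -> primrec F -> primrec G ->
  primrec (fun x => if b x then F x else G x).
Proof.
move=> hb hF hG.
apply: pr_ext (pr_add (pr_mul hb hF) (pr_mul (pr_neg hb) hG)) => x.
by case: (b x); rewrite /= !(mul1n, mul0n, addn0).
Qed.

Lemma pr_ifb (b c d : nat -> bool) : primrec b -> primrec c -> primrec d ->
  primrec (fun x => if b x then c x else d x : bool).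
Proof.
move=> hb hc hd; apply: pr_ext (pr_if hb hc hd) => x.
by case: (b x).
Qed.

Lemma pr_sum N (G : nat -> nat -> nat) :
  primrec N -> primrec (fun z => G (pi1 z) (pi2 z)) ->
  primrec (fun x => \sum_(i < N x) G x i).
Proof.
move=> hN hG.
apply: (@pr_ext (fun x => iteri (N x) (fun i r => r + G x i) 0)).
  move=> x; elim: (N x) => [|n IH] /=; first by rewrite big_ord0.
  by rewrite big_ord_recr /= IH.
apply: pr_iteri => //; first exact: pr_const.
apply: pr_add; first by repeat pr_base.
by apply: (pr_app2 hG); repeat pr_base.
Qed.

Lemma pr_has N (b : nat -> nat -> bool) :
  primrec N -> primrec (fun z => b (pi1 z) (pi2 z)) ->
  primrec (fun x => has (b x) (iota 0 (N x))).
Proof.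
move=> hN hb; apply: pr_ext (pr_leq (pr_const 1) (@pr_sum N b hN hb)) => x.
congr nat_of_bool; elim: (N x) => [|n IH]; first by rewrite big_ord0.
rewrite -[in RHS]addn1 iotaD has_cat big_ord_recr /= orbF -IH add0n.
by rewrite addn_gt0 lt0b.
Qed.

Ltac pr_hook := fail.

Ltac pr_step :=
  lazymatch goal with
  | |- primrec (fun x => @?F x + @?G x) => apply: (@pr_add F G)
  | |- primrec (fun x => @?F x - @?G x) => apply: (@pr_sub F G)
  | |- primrec (fun x => @?F x * @?G x) => apply: (@pr_mul F G)
  | |- primrec (fun x => @?F x ^ @?G x) => apply: (@pr_exp F G)
  | |- primrec (fun x => (@?F x).-1) => apply: (@pr_pred F)
  | |- primrec (fun x => (@?F x)./2) => apply: (@pr_half F)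
  | |- primrec (fun x => nat_of_bool (odd (@?F x))) => apply: (@pr_odd F)
  | |- primrec (fun x => nat_of_bool (@?F x <= @?G x)) =>
      apply: (@pr_leq F G)
  | |- primrec (fun x => nat_of_bool (eq_op (@?F x) (@?G x))) =>
      first [apply: (@pr_eq F G) | apply: (@pr_beq F G)]
  | |- primrec (fun x => nat_of_bool (@?F x && @?G x)) => apply: (@pr_and F G)
  | |- primrec (fun x => nat_of_bool (@?F x || @?G x)) => apply: (@pr_or F G)
  | |- primrec (fun x => nat_of_bool (~~ @?F x)) => apply: (@pr_neg F)
  | |- primrec (fun x => if _ then _ else _) => apply: pr_if
  | |- primrec (fun x => nat_of_bool (if _ then _ else _)) => apply: pr_ifb
  | |- primrec (fun x => nat_of_bool (has (@?b x) (iota 0 (@?N x)))) =>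
      apply: (@pr_has N b)
  | _ => first [pr_hook | pr_base]
  end.

Ltac pr := repeat (cbv beta; pr_step).

(** * Strings *)

Fixpoint sdec_rec (n c : nat) : string :=
  if n is n'.+1 then
    if c is c'.+1 then odd c' :: sdec_rec n' c'./2 else [::]
  else [::].

Definition sdec (c : nat) : string := sdec_rec c c.

Lemma sdec_recK n c : c <= n -> scode (sdec_rec n c) = c.
Proof.
elim: n c => [|n IH] [|c] //= hc; rewrite IH; last by lia.
by rewrite addn1 addnC odd_double_half.
Qed.

Lemma sdecK : cancel sdec scode.
Proof. by move=> c; rewrite /sdec sdec_recK. Qed.

Lemma scode_inj : injective scode.
Proof.
elim=> [|b s IH] [|b' s'] //=; rewrite ?addn1 // => -[e].
have eb : b = b'.
  have := congr1 odd e; rewrite !oddD !odd_double /=.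
  by case: (b); case: (b').
by rewrite eb in e *; congr cons; apply: IH; lia.
Qed.

Lemma scodeK : cancel scode sdec.
Proof. by move=> s; apply: scode_inj; rewrite sdecK. Qed.

Lemma size_scode s : size s <= scode s.
Proof. by elim: s => //= b s IH; lia. Qed.

Lemma scode_behead s : scode (behead s) = (scode s).-1./2.
Proof. by case: s => //= b s; rewrite addn1 /= half_bit_double || lia. Qed.

(** Removing the first letter of a string sends its code [c] to [c.-1./2]; letters and lengths are
    therefore primitive recursive in the code. *)
Definition sdrop (c j : nat) : nat := iteri j (fun _ r => r.-1./2) c.

Lemma sdropE c j : sdrop c j = scode (drop j (sdec c)).
Proof.
elim: j => [|j IH]; first by rewrite drop0 sdecK.
by rewrite /= -/(sdrop c j) IH -scode_behead -drop1 drop_drop.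
Qed.

Lemma scode_gt0 s : (0 < scode s) = (0 < size s).
Proof. by case: s => //= b s; rewrite addn1. Qed.

Lemma nth_sdrop c j : nth false (sdec c) j = odd (sdrop c j).-1.
Proof.
rewrite sdropE -[j in LHS]addn0 -nth_drop.
case: (drop j _) => //= b s; rewrite addn1 /= oddD odd_double.
by case: b.
Qed.

Lemma pr_sdrop F G :
  primrec F -> primrec G -> primrec (fun x => sdrop (F x) (G x)).
Proof. by move=> hF hG; apply: pr_iteri => //; pr. Qed.

Lemma pr_nth F G : primrec F -> primrec G ->
  primrec (fun x => nth false (sdec (F x)) (G x)).
Proof.
move=> hF hG; apply: (@pr_ext (fun x => odd (sdrop (F x) (G x)).-1)).
  by move=> x; rewrite nth_sdrop.
by pr; apply: pr_sdrop.
Qed.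

Lemma sum_ltn n k : \sum_(j < n) (j < k) = minn k n.
Proof.
elim: n => [|n IH]; first by rewrite big_ord0 minn0.
by rewrite big_ord_recr /= IH; lia.
Qed.

Lemma pr_size F : primrec F -> primrec (fun x => size (sdec (F x))).
Proof.
move=> hF; apply: (@pr_ext (fun x => \sum_(j < F x) (1 <= sdrop (F x) j))).
  move=> x;
    have h : size (sdec (F x)) <= F x by rewrite -[leqRHS]sdecK size_scode.
  under eq_bigr => j _ do rewrite sdropE scode_gt0 size_drop subn_gt0.
  by rewrite sum_ltn (minn_idPl h).
apply: (@pr_sum F (fun x j => 1 <= sdrop (F x) j)); pr.
by apply: pr_sdrop; pr; exact: pr_comp hF pr_pi1.
Qed.

Lemma prefix_nth (s t : string) : prefix s t =
  (size s <= size t) &&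
  ~~ has (fun j => nth false s j != nth false t j) (iota 0 (size s)).
Proof.
rewrite prefixE; apply/eqP/andP => [e|[h /hasPn H]].
  split; first by rewrite -{1}e size_take_min geq_minr.
  apply/hasPn => j; rewrite mem_iota add0n negbK => /andP[_ hj].
  by rewrite -{1}e nth_take.
apply: (@eq_from_nth _ false) => [|j]; rewrite size_takel // => hj.
rewrite nth_take //; have := H j; rewrite mem_iota /= add0n hj negbK.
by move=> /(_ isT)/eqP.
Qed.

Lemma pr_prefix F G : primrec F -> primrec G ->
  primrec (fun x => prefix (sdec (F x)) (sdec (G x))).
Proof.
apply: (@pr_app2 (fun a b => prefix (sdec a) (sdec b))).
have pr1 : primrec (fun z => size (sdec (pi1 z))) by apply: pr_size; pr.
have pr2 : primrec (fun z => size (sdec (pi2 z))) by apply: pr_size; pr.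
apply: pr_ext => [z|]; first by rewrite prefix_nth.
by pr; apply: pr_nth; pr.
Qed.

Ltac pr_hook ::=
  lazymatch goal with
  | |- primrec (fun x => size (sdec (@?F x))) => apply: (@pr_size F)
  | |- primrec (fun x => nat_of_bool (nth false (sdec (@?F x)) (@?G x))) =>
      apply: (@pr_nth F G)
  | |- primrec (fun x => nat_of_bool (prefix (sdec (@?F x)) (sdec (@?G x)))) =>
      apply: (@pr_prefix F G)
  end.

(** * Closure properties of Pi^1_1 *)

(* Arithmetic with a sequence of function variables [TApp 0], [TApp 1], ... *)
Inductive tm : Type :=
| TVar of nat
| TZero
| TSucc of tm
| TAdd of tm & tm
| TMul of tm & tm
| TApp of nat & tm.

Inductive fm : Type :=
| FEq of tm & tm
| FNot of fm
| FAnd of fm & fm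
| FAll of fm.

Definition scons (n : nat) (e : nat -> nat) (i : nat) : nat :=
  if i is j.+1 then e j else n.

Fixpoint tev (G : nat -> nat -> nat) (e : nat -> nat) (t : tm) : nat :=
  match t with
  | TVar i => e i
  | TZero => 0
  | TSucc t => (tev G e t).+1
  | TAdd t u => tev G e t + tev G e u
  | TMul t u => tev G e t * tev G e u
  | TApp i t => G i (tev G e t)
  end.

Fixpoint hd (G : nat -> nat -> nat) (e : nat -> nat) (p : fm) : Prop :=
  match p with
  | FEq t u => tev G e t = tev G e u
  | FNot p => ~ hd G e p
  | FAnd p q => hd G e p /\ hd G e q
  | FAll p => forall n, hd G (scons n e) p
  end.

Lemma hd_all G e p : hd G e (FAll p) <-> forall n, hd G (scons n e) p.
Proof. by []. Qed.

Lemma hd_and G e p q : hd G e (FAnd p q) <-> hd G e p /\ hd G e q.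
Proof. by []. Qed.

Definition FOr (p q : fm) : fm := FNot (FAnd (FNot p) (FNot q)).
Definition FImp (p q : fm) : fm := FNot (FAnd p (FNot q)).
Definition FEx (p : fm) : fm := FNot (FAll (FNot p)).

Lemma hd_or G e p q : hd G e (FOr p q) <-> hd G e p \/ hd G e q.
Proof. by rewrite /= -not_orE notE. Qed.

Lemma hd_imp G e p q : hd G e (FImp p q) <-> (hd G e p -> hd G e q).
Proof.
split=> /= [h hp|h [hp hq]]; last exact: hq (h hp).
by apply: contrapT => hq; apply: h.
Qed.

Lemma hd_ex G e p : hd G e (FEx p) <-> exists n, hd G (scons n e) p.
Proof.
split=> /= [h|[n hn] h]; last exact: h hn.
by apply: contrapT => hn; apply: h => n hp; apply: hn; exists n.
Qed.

(* An injective polynomial pairing: it addresses the columns of a function by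
   a term of the language *)
Definition col (n t : nat) : nat := (n + t) * (n + t) + n.

Lemma col_inj n t n' t' : col n t = col n' t' -> n = n' /\ t = t'.
Proof.
rewrite /col => h; have e : n + t = n' + t' by nia.
by rewrite e in h; lia.
Qed.

Lemma uncol (T : Type) (H : nat -> nat -> T) :
  exists h : nat -> T, forall n t, h (col n t) = H n t.
Proof.
have /choice[h hh] : forall v, exists y, forall n t, v = col n t -> y = H n t.
  move=> v; have [[[n t] /= ->]|no] := pselect (exists nt, v = col nt.1 nt.2).
    by exists (H n t) => n' t' /col_inj[-> ->].
  by exists (H 0 0) => n t e; case: no; exists (n, t).
by exists h => n t; apply: esym; rewrite (hh _ n t).
Qed.

(* [m i] is the new name of the function variable [i], restricted to a column
   given by a number variable if there is one; [s] renames number variables *)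
Definition tcol (i : nat) (c : option nat) (u : tm) : tm :=
  if c is Some v then
    TApp i (TAdd (TMul (TAdd (TVar v) u) (TAdd (TVar v) u)) (TVar v))
  else TApp i u.

Fixpoint trt (m : nat -> nat * option nat) (s : nat -> nat) (t : tm) : tm :=
  match t with
  | TVar i => TVar (s i)
  | TZero => TZero
  | TSucc t => TSucc (trt m s t)
  | TAdd t u => TAdd (trt m s t) (trt m s u)
  | TMul t u => TMul (trt m s t) (trt m s u)
  | TApp i t => tcol (m i).1 (m i).2 (trt m s t)
  end.

Fixpoint trf (m : nat -> nat * option nat) (s : nat -> nat) (p : fm) : fm :=
  match p with
  | FEq t u => FEq (trt m s t) (trt m s u)
  | FNot p => FNot (trf m s p)
  | FAnd p q => FAnd (trf m s p) (trf m s q)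
  | FAll p => FAll (trf (fun i => ((m i).1, omap S (m i).2))
                        (fun i => if i is j.+1 then (s j).+1 else 0) p)
  end.

Definition mcol (e : nat -> nat) (c : option nat) (t : nat) : nat :=
  if c is Some v then col (e v) t else t.

Lemma tev_tr m s G e t : tev G e (trt m s t) =
  tev (fun i u => G (m i).1 (mcol e (m i).2 u)) (fun i => e (s i)) t.
Proof.
elim: t => //= [t -> //|t -> u -> //|t -> u -> //|i t <-].
by case: (m i) => j [v|].
Qed.

Lemma hd_tr m s G e p : hd G e (trf m s p) <->
  hd (fun i u => G (m i).1 (mcol e (m i).2 u)) (fun i => e (s i)) p.
Proof.
elim: p m s e => /= [t u|p IH|p IHp q IHq|p IH] m s e.
- by rewrite !tev_tr.
- by rewrite IH.
- by rewrite IHp IHq.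
- split=> h n; move: (h n); rewrite IH /=.
  + congr hd; last by apply: funext => -[|j].
    by apply: funext => i; apply: funext => u; case: (m i).2.
  + congr hd; last by apply: funext => -[|j].
    by apply: funext => i; apply: funext => u; case: (m i).2.
Qed.

(** Function variable 0 stays free and is read as [f], so that [pi_allf] can bind it later; all the
    others are universally quantified. Every number variable is read as the single number [x], which
    may be a packed tuple. *)
Definition Pi (P : (nat -> nat) -> nat -> Prop) : Prop :=
  exists p : fm, forall f x,
    P f x <-> forall G, G 0 = f -> hd G (fun=> x) p.

Lemma pi_iff P Q : (forall f x, P f x <-> Q f x) -> Pi P -> Pi Q.
Proof. by move=> h [p hp]; exists p => f x; rewrite -h. Qed.

Lemma pi_and P Q : Pi P -> Pi Q -> Pi (fun f x => P f x /\ Q f x).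
Proof.
move=> [p hp] [q hq]; exists (FAnd p q) => f x; rewrite hp hq.
split=> [[h1 h2] G G0|h]; first by split; [apply: h1|apply: h2].
by split=> G /h[].
Qed.

(** Renaming gives the bound function variables of the two formulas odd and even names, so that a
    counterexample to each of them combines into one counterexample to the disjunction. *)
Lemma pi_or P Q : Pi P -> Pi Q -> Pi (fun f x => P f x \/ Q f x).
Proof.
move=> [p hp] [q hq].
pose mp i := (if i is j.+1 then j.*2.+1 else 0, None : option nat).
pose mq i := (if i is j.+1 then j.*2.+2 else 0, None : option nat).
exists (FOr (trf mp id p) (trf mq id q)) => f x; rewrite hp hq; split.
- by move=> [h|h] G G0; rewrite hd_or !hd_tr; [left|right]; apply: h.
- move=> h; apply: contrapT; rewrite not_orE -!existsNE => -[[G1 h1] [G2 h2]].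
  move: h1 h2 => /not_implyP[G10 n1] /not_implyP[G20 n2].
  pose G i := if i is j.+1 then if odd j then G2 j./2.+1 else G1 j./2.+1 else f.
  have := h G erefl; rewrite hd_or !hd_tr; case=> hG.
  + apply: n1; move: hG; congr hd; apply: funext => -[|j];
      first by rewrite /= G10.
    by apply: funext => u; rewrite /= odd_double doubleK.
  + apply: n2; move: hG; congr hd; apply: funext => -[|j];
      first by rewrite /= G20.
    by apply: funext => u; rewrite /= odd_double /= uphalf_double.
Qed.

(** The equation of the Cantor pairing multiplied by 2, because the language has no division. *)
Definition FPair (x y z : nat) : fm :=
  FEq (TAdd (TVar z) (TVar z))
    (TAdd (TAdd (TVar y) (TVar y))
      (TMul (TAdd (TVar y) (TVar x)) (TSucc (TAdd (TVar y) (TVar x))))).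

Lemma hd_pair G e x y z : hd G e (FPair x y z) <-> e z = pair_nat (e x) (e y).
Proof. by rewrite /=; have := pair_spec (e x) (e y); split; lia. Qed.

Definition mid (i : nat) : nat * option nat := (i, None).

Lemma pi_all_pair P : Pi P -> Pi (fun f x => forall n, P f (pair_nat x n)).
Proof.
move=> [p hp].
exists (FAll (FAll (FImp (FPair 2 1 0) (trf mid (fun=> 0) p)))) => f x; split.
- move=> h G G0; apply/hd_all => n; apply/hd_all => z;
    rewrite hd_imp hd_pair hd_tr /= => ->.
  by move: (h n); rewrite hp => /(_ G G0).
- move=> h n; rewrite hp => G G0;
    have /hd_all/(_ n)/hd_all/(_ (pair_nat x n)) := h G G0.
  by rewrite hd_imp hd_pair hd_tr /=; apply.
Qed.

(** The number quantifier moves inside the function quantifiers: the formula for [n] reads only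
    column [n] of each bound function, and by choice counterexamples for all [n] can be stored in
    the columns simultaneously. Variable 0 is exempt, being the parameter [f]. *)
Lemma pi_ex_pair P : Pi P -> Pi (fun f x => exists n, P f (pair_nat x n)).
Proof.
move=> [p hp].
pose m i := (i, if i is 0 then None else Some 1).
exists (FEx (FEx (FAnd (FPair 2 1 0) (trf m (fun=> 0) p)))) => f x; split.
- move=> [n]; rewrite hp => h G G0; rewrite hd_ex; exists n; rewrite hd_ex.
  exists (pair_nat x n); split; first by rewrite hd_pair.
  by rewrite hd_tr; apply: h; rewrite -G0.
- move=> h; apply: contrapT; rewrite -forallNE => no.
  have /choice[K hK] : forall n, exists G, G 0 = f /\
      ~ hd G (fun=> pair_nat x n) p.
    move=> n; have := no n; rewrite hp -existsNE => -[G /not_implyP[G0 hG]].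
    by exists G.
  have /choice[H hH] : forall i, exists h, forall n t, h (col n t) = K n i t.
    by move=> i; apply: uncol.
  pose G i := if i is 0 then f else H i.
  have := h G erefl; rewrite hd_ex => -[n]; rewrite hd_ex => -[z].
  rewrite hd_and hd_pair hd_tr /= => -[->].
  have [K0 nK] := hK n; move=> hG; apply: nK; move: hG; congr hd.
  by apply: funext => -[|i]; apply: funext => t /=; rewrite ?K0 ?hH.
Qed.

Lemma pi_allf P : Pi P -> Pi (fun _ x => forall g, P g x).
Proof.
move=> [p hp]; exists (trf (fun i => (i.+1, None)) id p) => f x; split.
- by move=> h G _; rewrite hd_tr; apply: (proj1 (hp (G 1) x)).
- move=> h g; rewrite hp => G G0.
  by have := h (fun i => if i is j.+1 then G j else f) erefl; rewrite hd_tr.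
Qed.

Definition arith_fun (F : nat -> nat) : Prop :=
  exists q : fm, forall G e, hd G e q <-> e 0 = F (e 1).

Lemma pi_arith P F : Pi P -> arith_fun F -> Pi (fun f x => P f (F x)).
Proof.
move=> [p hp] [q hq].
exists (FAll (FImp q (trf mid (fun=> 0) p))) => f x; rewrite hp; split.
- by move=> h G G0; apply/hd_all => n; rewrite hd_imp hq hd_tr /= => ->;
    apply: h.
- move=> h G G0; have /hd_all/(_ (F x)) := h G G0.
  by rewrite hd_imp hq hd_tr /=; apply.
Qed.

Lemma arith_zero : arith_fun (fun=> 0).
Proof. by exists (FEq (TVar 0) TZero). Qed.

Lemma arith_succ : arith_fun S.
Proof. by exists (FEq (TVar 0) (TSucc (TVar 1))). Qed.

Lemma arith_pi1 : arith_fun pi1.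
Proof.
exists (FEx (FPair 1 0 2)) => G e; rewrite hd_ex; split.
  by move=> [n]; rewrite hd_pair /= => ->; rewrite pi1_pair.
by move=> h; exists (pi2 (e 1)); rewrite hd_pair /= h pair_pi.
Qed.

Lemma arith_pi2 : arith_fun pi2.
Proof.
exists (FEx (FPair 0 1 2)) => G e; rewrite hd_ex; split.
  by move=> [n]; rewrite hd_pair /= => ->; rewrite pi2_pair.
by move=> h; exists (pi1 (e 1)); rewrite hd_pair /= h pair_pi.
Qed.

Lemma arith_pair F K : arith_fun F -> arith_fun K ->
  arith_fun (fun x => pair_nat (F x) (K x)).
Proof.
move=> [p hp] [q hq].
pose s k i := if i is 0 then k else 3.
exists (FEx (FEx (FAnd (FAnd (trf mid (s 1) p) (trf mid (s 0) q))
                       (FPair 1 0 2)))) => G e; rewrite hd_ex; split.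
- move=> [a]; rewrite hd_ex => -[b].
  by rewrite !hd_and !hd_tr hp hq hd_pair /= => -[[-> ->]].
- move=> h; exists (F (e 1)); rewrite hd_ex; exists (K (e 1)).
  by split; [split; rewrite hd_tr ?hp ?hq|rewrite hd_pair].
Qed.

Lemma arith_comp F K : arith_fun F -> arith_fun K ->
  arith_fun (fun x => F (K x)).
Proof.
move=> [p hp] [q hq].
exists (FEx (FAnd (trf mid (fun i => if i is 0 then 0 else 2) q)
                  (trf mid (fun i => if i is 0 then 1 else 0) p))) => G e.
rewrite hd_ex; split.
- by move=> [n]; rewrite hd_and !hd_tr hp hq /= => -[-> ->].
- by move=> h; exists (K (e 1)); split; rewrite hd_tr ?hp ?hq.
Qed.

Lemma pi_all (P : (nat -> nat) -> nat -> nat -> Prop) :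
  Pi (fun f z => P f (pi1 z) (pi2 z)) -> Pi (fun f x => forall n, P f x n).
Proof.
move=> /pi_all_pair; apply: pi_iff => f x.
by split=> h n; have := h n; rewrite !pairE.
Qed.

Lemma pi_ex (P : (nat -> nat) -> nat -> nat -> Prop) :
  Pi (fun f z => P f (pi1 z) (pi2 z)) -> Pi (fun f x => exists n, P f x n).
Proof.
move=> /pi_ex_pair; apply: pi_iff => f x.
by split=> -[n]; rewrite ?pairE => h; exists n; rewrite ?pairE.
Qed.

(** Substitution needs the complement of the graph: [P f (F x)] is equivalent to
    [forall u, F x <> u \/ P f u]. *)
Definition co_graph (F : nat -> nat) : Prop :=
  Pi (fun _ z => F (pi1 z) <> pi2 z).

Lemma pi_neq_pair : Pi (fun _ z => pi1 z <> pi2 z).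
Proof.
exists (FAll (FAll (FImp (FPair 1 0 2) (FNot (FEq (TVar 1) (TVar 0))))))=> f x.
split=> [h G _|h].
  apply/hd_all => a; apply/hd_all => b; rewrite hd_imp hd_pair /= => e.
  by rewrite e !pairE in h.
have /hd_all/(_ (pi1 x))/hd_all/(_ (pi2 x)) := h (fun=> f) erefl.
rewrite hd_imp hd_pair /=.
by apply; rewrite pair_pi.
Qed.

Lemma pi_app_pair : Pi (fun f z => f (pi1 z) <> pi2 z).
Proof.
exists (FAll (FAll (FImp (FPair 1 0 2) (FNot (FEq (TApp 0 (TVar 1)) (TVar 0)))))) => f x.
split=> [h G G0|h].
  apply/hd_all => a; apply/hd_all => b; rewrite hd_imp hd_pair /= => e.
  by rewrite e !pairE in h; rewrite G0.
have /hd_all/(_ (pi1 x))/hd_all/(_ (pi2 x)) := h (fun=> f) erefl.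
rewrite hd_imp hd_pair /=.
by apply; rewrite pair_pi.
Qed.

Lemma co_graph_arith F : arith_fun F -> co_graph F.
Proof.
move=> hF; have := pi_arith pi_neq_pair
  (arith_pair (arith_comp hF arith_pi1) arith_pi2).
by apply: pi_iff => _ x; rewrite !pairE.
Qed.

Lemma pi_sub P F : Pi P -> co_graph F -> Pi (fun f x => P f (F x)).
Proof.
move=> hP hF.
have h : Pi (fun f x => forall u, F x <> u \/ P f u).
  by apply: pi_all; apply: pi_or => //; apply: pi_arith hP arith_pi2.
apply: pi_iff h => f x; split=> [h|h u]; first by case: (h (F x)).
by have [<-|] := pselect (F x = u); [right|left].
Qed.

Lemma co_graph_comp F K : co_graph F -> co_graph K ->
  co_graph (fun x => F (K x)).
Proof.
move=> hF hK; rewrite /co_graph.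
have h : Pi (fun _ z => forall u, K (pi1 z) <> u \/ F u <> pi2 z).
  apply: pi_all; apply: pi_or.
    have := pi_arith hK (arith_pair (arith_comp arith_pi1 arith_pi1) arith_pi2).
    by apply: pi_iff => _ x; rewrite !pairE.
  have := pi_arith hF (arith_pair arith_pi2 (arith_comp arith_pi2 arith_pi1)).
  by apply: pi_iff => _ x; rewrite !pairE.
apply: pi_iff h => f x; split=> [h|h u]; first by case: (h (K (pi1 x))).
by have [<-|] := pselect (K (pi1 x) = u); [right|left].
Qed.

Lemma co_graph_pair F K : co_graph F -> co_graph K ->
  co_graph (fun x => pair_nat (F x) (K x)).
Proof.
move=> hF hK; rewrite /co_graph.
have h : Pi (fun _ z => F (pi1 z) <> pi1 (pi2 z) \/ K (pi1 z) <> pi2 (pi2 z)).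
  apply: pi_or.
    have := pi_arith hF (arith_pair arith_pi1 (arith_comp arith_pi1 arith_pi2)).
    by apply: pi_iff => _ x; rewrite !pairE.
  have := pi_arith hK (arith_pair arith_pi1 (arith_comp arith_pi2 arith_pi2)).
  by apply: pi_iff => _ x; rewrite !pairE.
apply: pi_iff h => f x; split=> [h e|h].
  by rewrite -e !pairE in h; case: h.
apply: contrapT; rewrite not_orE !notE => -[e1 e2]; apply: h.
by rewrite e1 e2 pair_pi.
Qed.

Lemma pi_app_neq F K : co_graph F -> co_graph K ->
  Pi (fun f x => f (F x) <> K x).
Proof.
move=> hF hK; have := pi_sub pi_app_pair (co_graph_pair hF hK).
by apply: pi_iff => f x; rewrite !pairE.
Qed.

(** A number is not the value of the recursion iff every sequence [h] either violates the recursion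
    equations somewhere or differs from that number at the last index. The variable [u] names [h i],
    which occurs inside the argument of [K]. *)
Lemma co_graph_rec F K : co_graph F -> co_graph K ->
  co_graph (fun x => iteri (pi2 x)
    (fun i r => K (pair_nat (pi1 x) (pair_nat i r))) (F (pi1 x))).
Proof.
move=> hF hK; rewrite /co_graph.
have c1 := co_graph_arith arith_pi1; have c2 := co_graph_arith arith_pi2.
have h : Pi (fun _ z => forall h : nat -> nat,
    h 0 <> F (pi1 (pi1 z)) \/
    (exists i, forall u, h i <> u \/
       h i.+1 <> K (pair_nat (pi1 (pi1 z)) (pair_nat i u))) \/
    h (pi2 (pi1 z)) <> pi2 z).
  apply: pi_allf; apply: pi_or.
    apply: pi_app_neq; first exact: co_graph_arith arith_zero.
    exact: co_graph_comp hF (co_graph_comp c1 c1).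
  apply: pi_or; last exact: pi_app_neq (co_graph_comp c2 c1) c2.
  apply: pi_ex; apply: pi_all; apply: pi_or.
    exact: pi_app_neq (co_graph_comp c2 c1) c2.
  apply: pi_app_neq.
    exact: co_graph_comp (co_graph_arith arith_succ) (co_graph_comp c2 c1).
  apply: (co_graph_comp hK); apply: co_graph_pair.
    exact: co_graph_comp c1 (co_graph_comp c1 (co_graph_comp c1 c1)).
  exact: co_graph_pair (co_graph_comp c2 c1) c2.
apply: pi_iff h => f z; set a := pi1 (pi1 z).
set g := fun i r => K (pair_nat a (pair_nat i r)); split=> [h e|h k].
- have [//|[[i /(_ _)]|]] := h (fun n => iteri n g (F a)); last exact.
  by move=> /(_ (iteri i g (F a)))[].
- apply: contrapT; rewrite !not_orE !notE => -[k0 [kS kn]]; apply: h.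
  rewrite -kn; elim: (pi2 (pi1 z)) => [|n IH] //=; rewrite IH.
  apply: contrapT => ne; apply: kS; exists n => u.
  by have [<-|] := pselect (k n = u); [right; apply: nesym|left].
Qed.

Lemma co_graph_primrec F : primrec F -> co_graph F.
Proof.
elim=> {F} [||||F K _ hF _ hK|F K _ hF _ hK|F K _ hF _ hK].
- exact: co_graph_arith arith_zero.
- exact: co_graph_arith arith_succ.
- exact: co_graph_arith arith_pi1.
- exact: co_graph_arith arith_pi2.
- exact: co_graph_pair.
- exact: co_graph_comp.
- exact: co_graph_rec.
Qed.

Lemma pi_comp P F : Pi P -> primrec F -> Pi (fun f x => P f (F x)).
Proof. by move=> hP /co_graph_primrec; apply: pi_sub. Qed.

Lemma pi_bool (b : nat -> bool) : primrec b -> Pi (fun _ x => b x).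
Proof.
move=> hb; have := pi_comp pi_neq_pair (pr_pair hb (pr_const 0)).
by apply: pi_iff => _ x; rewrite !pairE; case: (b x).
Qed.

Lemma pi_imp (b : nat -> bool) P :
  primrec b -> Pi P -> Pi (fun f x => b x -> P f x).
Proof.
move=> /pr_neg/pi_bool hb /(pi_or hb); apply: pi_iff => f x.
by case: (b x) => /=; split; [case=> //|move=> h; right; apply: h|done|left].
Qed.

Lemma pi_app F K : primrec F -> primrec K -> Pi (fun f x => f (F x) <> K x).
Proof. by move=> /co_graph_primrec hF /co_graph_primrec; apply: pi_app_neq. Qed.

Lemma pi_app0 F : primrec F -> Pi (fun f x => f (F x) = 0).
Proof.
move=> hF.
have h : Pi (fun f x => forall u, f (F x) <> u \/ u == 0).
  apply: pi_all; apply: pi_or; last by apply: pi_bool; pr.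
  apply: pi_app; last by pr.
  exact: pr_comp hF pr_pi1.
apply: pi_iff h => f x; split=> [/(_ (f (F x)))[//|/eqP//]|e u].
by rewrite e; case: u => [|u]; [right|left].
Qed.

(** * Return to the language with one function variable *)

Fixpoint num (n : nat) : term := if n is n'.+1 then Succ (num n') else Zero.

Lemma teval_num f e n : teval f e (num n) = n.
Proof. by elim: n => //= n ->. Qed.

Fixpoint tot (t : tm) : term :=
  match t with
  | TVar i => Var i
  | TZero => Zero
  | TSucc t => Succ (tot t)
  | TAdd t u => Add (tot t) (tot u)
  | TMul t u => Mul (tot t) (tot u)
  | TApp i t => App (Add (Mul (Add (num i) (tot t)) (Add (num i) (tot t)))
                         (num i))
  end.

Fixpoint tof (p : fm) : formula :=
  match p with
  | FEq t u => Eq (tot t) (tot u)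
  | FNot p => Not (tof p)
  | FAnd p q => And (tof p) (tof q)
  | FAll p => All (tof p)
  end.

Lemma teval_tot f e t :
  teval f e (tot t) = tev (fun i u => f (col i u)) (nth 0 e) t.
Proof.
by elim: t => //= [t ->|t -> u ->|t -> u ->|i t ->] //; rewrite !teval_num.
Qed.

Lemma holds_tof f e p :
  holds f e (tof p) <-> hd (fun i u => f (col i u)) (nth 0 e) p.
Proof.
elim: p e => /= [t u|p IH|p IHp q IHq|p IH] e.
- by rewrite !teval_tot.
- by rewrite IH.
- by rewrite IHp IHq.
- have E n : nth 0 (n :: e) = scons n (nth 0 e) by apply: funext => -[].
  by split=> h n; move: (h n); rewrite IH E.
Qed.

(** Function variable [i] becomes column [i] of the single function. Three entries cover all the
    codings in use, as missing entries are read as 0. *)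
Lemma Pi_formula (P : nat -> Prop) : Pi (fun _ => P) ->
  exists p, forall e,
    P (pair_nat (nth 0 e 0) (pair_nat (nth 0 e 1) (nth 0 e 2))) <->
    forall f, holds f e p.
Proof.
move=> [p hp].
exists (tof (FAll (FAll (FImp (FAnd (FPair 3 4 1) (FPair 2 1 0))
                              (trf mid (fun=> 0) p))))) => e.
rewrite (hp (fun=> 0)); split.
- move=> h f; rewrite holds_tof; apply/hd_all => w; apply/hd_all => z;
    rewrite hd_imp hd_tr.
  rewrite hd_and !hd_pair /= => -[-> ->].
  set y := pair_nat _ _ in h *.
  have h2 : P y by rewrite (hp (fun=> 0)).
  by move/(hp (fun u => f (col 0 u))): h2; apply.
- move=> h G G0; have [g hg] := uncol G.
  set w := pair_nat (nth 0 e 1) (nth 0 e 2); set z := pair_nat _ w.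
  move: (h g); rewrite holds_tof => /hd_all/(_ w)/hd_all/(_ z).
  rewrite hd_imp hd_tr; have -> : (fun i u => g (col i u)) = G.
    by apply: funext => i; apply: funext => u; rewrite hg.
  by apply; split; rewrite hd_pair.
Qed.

(** * A universal Pi^1_1 set *)

Fixpoint tcode (t : term) : nat :=
  match t with
  | Var i => pair_nat 0 i
  | Zero => pair_nat 1 0
  | Succ t => pair_nat 2 (tcode t)
  | Add t u => pair_nat 3 (pair_nat (tcode t) (tcode u))
  | Mul t u => pair_nat 4 (pair_nat (tcode t) (tcode u))
  | App t => pair_nat 5 (tcode t)
  end.

Fixpoint fcode (p : formula) : nat :=
  match p with
  | Eq t u => pair_nat 6 (pair_nat (tcode t) (tcode u))
  | Not p => pair_nat 7 (fcode p)
  | And p q => pair_nat 8 (pair_nat (fcode p) (fcode q))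
  | All p => pair_nat 9 (fcode p)
  end.

Fixpoint ecode (e : seq nat) : nat :=
  if e is n :: e' then pair_nat n (ecode e') else 0.

Definition enth (e i : nat) : nat := pi1 (iteri i (fun _ => pi2) e).

(** Because 0 codes the pair of zeros, reading past the end of a coded environment gives 0, in
    agreement with the default of [nth 0]. *)
Lemma pair00 : pair_nat 0 0 = 0. Proof. by []. Qed.

Lemma pi1_0 : pi1 0 = 0. Proof. by rewrite -{1}pair00 pi1_pair. Qed.
Lemma pi2_0 : pi2 0 = 0. Proof. by rewrite -{1}pair00 pi2_pair. Qed.

Lemma iteri_pi2S i z : iteri i.+1 (fun _ => pi2) z = iteri i (fun _ => pi2) (pi2 z).
Proof. by elim: i => //= i ->. Qed.

Lemma enth_ecode e i : enth (ecode e) i = nth 0 e i.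
Proof.
have Z j : iteri j (fun _ => pi2) 0 = 0.
  by elim: j => //= j ->; exact: pi2_0.
rewrite /enth; elim: e i => [|n e IH] [|i].
- exact: pi1_0.
- by rewrite nth_nil Z pi1_0.
- by rewrite /= pi1_pair.
- by rewrite iteri_pi2S /= pi2_pair IH.
Qed.

(* A function [g] codes a valuation: [g (pair_nat a e)] is the value of the term
   with code [a] in the environment [e], or, if [a] codes a formula, [0] when the
   formula is true there and positive when it is false; for a false [All p] it
   is [k.+1] with [k] a counterexample. The value of the function variable at
   [k] is [g (pair_nat (pair_nat 10 k) 0)]. The constraint number [n] says that
   [g] is correct at [a] and [e], for the instance [m] if [a] codes [All p]. *)
Section Constraint.
Variables (g : nat -> nat) (n : nat).

Let a := pi1 n.
Let e := pi1 (pi2 n).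
Let m := pi2 (pi2 n).
Let r := pi2 a.

Definition qval := pair_nat a e.
Definition qsub := pair_nat r e.
Definition qsub1 := pair_nat (pi1 r) e.
Definition qsub2 := pair_nat (pi2 r) e.
Definition qapp := pair_nat (pair_nat 10 (g qsub)) 0.
Definition qall := pair_nat r (pair_nat m e).
Definition qwit := pair_nat r (pair_nat (g qval).-1 e).

Definition constraint : bool :=
  if pi1 a == 0 then g qval == enth e r else
  if pi1 a == 1 then g qval == 0 else
  if pi1 a == 2 then g qval == (g qsub).+1 else
  if pi1 a == 3 then g qval == g qsub1 + g qsub2 else
  if pi1 a == 4 then g qval == g qsub1 * g qsub2 else
  if pi1 a == 5 then g qval == g qapp else
  if pi1 a == 6 then (g qval == 0) == (g qsub1 == g qsub2) else
  if pi1 a == 7 then (g qval == 0) == (g qsub != 0) else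
  if pi1 a == 8 then (g qval == 0) == (g qsub1 == 0) && (g qsub2 == 0) else
  if pi1 a == 9 then if g qval == 0 then g qall == 0 else g qwit != 0 else
  true.

Definition available (L : nat) : bool :=
  [&& qval < L, qsub < L, qsub1 < L, qsub2 < L, qapp < L, qall < L & qwit < L].

End Constraint.

Lemma constraint_ext g g' n L : (forall k, k < L -> g' k = g k) ->
  available g n L -> available g' n L /\ constraint g' n = constraint g n.
Proof.
move=> h /and5P[h0 h1 h2 h3 /and3P[h4 h5 h6]].
have e4 : qapp g' n = qapp g n by rewrite /qapp h.
have e6 : qwit g' n = qwit g n by rewrite /qwit h.
split; first by rewrite /available e4 e6; apply/and5P; split=> //; apply/and3P.
by rewrite /constraint e4 e6 !h.
Qed.

Definition sat (g : nat -> nat) : Prop := forall n, constraint g n.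

(** On codes of formulas the zeros of a correct valuation are determined by the function that it
    stores, and every function is stored by some correct valuation. Quantifying over valuations thus
    replaces quantifying over functions. *)
Definition univ : set nat := [set x | forall g, sat g -> g x = 0].

Lemma sat_at g a e m : sat g ->
  constraint g (pair_nat a (pair_nat e m)).
Proof. exact. Qed.

Definition fun_of (g : nat -> nat) (k : nat) : nat :=
  g (pair_nat (pair_nat 10 k) 0).

Lemma sat_term g t e : sat g ->
  g (pair_nat (tcode t) (ecode e)) = teval (fun_of g) e t.
Proof.
move=> hg; have C t' := sat_at (tcode t') (ecode e) 0 hg.
elim: t => [i||t IH|t IHt u IHu|t IHt u IHu|t IH].
- by have /= := C (Var i);
    rewrite /constraint /qval /= !pairE /= enth_ecode => /eqP.
- by have /= := C Zero; rewrite /constraint /qval /= !pairE /= => /eqP.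
- by have /= := C (Succ t);
    rewrite /constraint /qval /qsub /= !pairE /= IH => /eqP.
- have /= := C (Add t u).
  by rewrite /constraint /qval /qsub1 /qsub2 /= !pairE /= IHt IHu => /eqP.
- have /= := C (Mul t u).
  by rewrite /constraint /qval /qsub1 /qsub2 /= !pairE /= IHt IHu => /eqP.
- have /= := C (App t).
  by rewrite /constraint /qval /qapp /qsub /= !pairE /= IH => /eqP.
Qed.

Lemma sat_formula g p e : sat g ->
  g (pair_nat (fcode p) (ecode e)) = 0 <-> holds (fun_of g) e p.
Proof.
move=> hg; elim: p e => [t u|p IH|p IHp q IHq|p IH] e;
  have C m a := @sat_at g a (ecode e) m hg.
- have := C 0 (fcode (Eq t u)).
  rewrite /constraint /qval /qsub1 /qsub2 !pairE /= !(sat_term _ _ hg) => /eqP E.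
  by split=> [/eqP|/eqP]; rewrite ?E => /eqP // h; apply/eqP; rewrite E h.
- have := C 0 (fcode (Not p)).
  rewrite /constraint /qval /qsub !pairE /= => /eqP E.
  split=> [/eqP|h]; first by rewrite E => /eqP h /IH.
  by apply/eqP; rewrite E; apply/eqP => /IH.
- have := C 0 (fcode (And p q)).
  rewrite /constraint /qval /qsub1 /qsub2 !pairE /= => /eqP E.
  split=> [/eqP|[/IHp/eqP hp /IHq/eqP hq]].
    by rewrite E => /andP[/eqP/IHp hp /eqP/IHq hq].
  by apply/eqP; rewrite E hp hq.
- have := C ^~ (fcode (All p)).
  rewrite /constraint /qval /qall /qwit => H.
  split=> [h n|h].
    have := H n; rewrite !pairE /= h /= -[pair_nat n _]/(ecode (n :: e)).
    by move=> /eqP/IH.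
  apply/eqP; have := H 0; rewrite !pairE /=; case: eqP => // _.
  by rewrite -[pair_nat _.-1 _]/(ecode (_ :: e)) => /eqP; rewrite IH.
Qed.

Section Valuation.
Variable f : nat -> nat.

(** The argument [n] is fuel and suffices once it exceeds [a]: components are smaller than [a]
    unless the tag is 0, and there no recursive value is used. For a false universal formula a
    counterexample is chosen classically. *)
Fixpoint val_rec (n a : nat) : nat -> nat :=
  if n is n'.+1 then
    let v := val_rec n' (pi2 a) in
    let v1 := val_rec n' (pi1 (pi2 a)) in
    let v2 := val_rec n' (pi2 (pi2 a)) in
    fun e =>
      if pi1 a == 0 then enth e (pi2 a) else
      if pi1 a == 1 then 0 else
      if pi1 a == 2 then (v e).+1 else
      if pi1 a == 3 then v1 e + v2 e else
      if pi1 a == 4 then v1 e * v2 e else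
      if pi1 a == 5 then f (v e) else
      if pi1 a == 6 then nat_of_bool (v1 e != v2 e) else
      if pi1 a == 7 then nat_of_bool (v e == 0) else
      if pi1 a == 8 then nat_of_bool (~~ ((v1 e == 0) && (v2 e == 0))) else
      if pi1 a == 9 then
        if pselect (exists m, v (pair_nat m e) <> 0) is left h
        then (projT1 (cid h)).+1 else 0
      else if pi1 a == 10 then f (pi2 a) else 0
  else fun=> 0.

Lemma pi2_lt a : pi1 a != 0 -> pi2 a < a.
Proof. by have := pair_bound (pi1 a) (pi2 a); rewrite pair_pi; lia. Qed.

Lemma val_rec_stable n n' a : a < n -> a < n' -> val_rec n a = val_rec n' a.
Proof.
elim: n n' a => [|n IH] [|n'] a // hn hn'; apply: funext => e /=.
have [//|h] := eqVneq (pi1 a) 0.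
have h0 := pi2_lt h; have h1 := pi1_le (pi2 a); have h2 := pi2_le (pi2 a).
by rewrite (IH n' (pi2 a)) 1?(IH n' (pi1 (pi2 a))) 1?(IH n' (pi2 (pi2 a))); lia.
Qed.

Definition valuation (q : nat) : nat := val_rec (pi1 q).+1 (pi1 q) (pi2 q).

Lemma valuation_sat : sat valuation.
Proof.
move=> n; rewrite /constraint /qval /qsub /qsub1 /qsub2 /qapp /qall /qwit.
set a := pi1 n; set e := pi1 (pi2 n); set m := pi2 (pi2 n).
have E b e' : b < a -> valuation (pair_nat b e') = val_rec a b e'.
  by move=> hb; rewrite /valuation !pairE (@val_rec_stable _ a).
have [h|h] := eqVneq (pi1 a) 0; first by rewrite /valuation !pairE /= h.
have h0 := pi2_lt h; have h1 := leq_ltn_trans (pi1_le (pi2 a)) h0.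
have h2 := leq_ltn_trans (pi2_le (pi2 a)) h0.
have V e' : valuation (pair_nat a e') = val_rec a.+1 a e'.
  by rewrite /valuation !pairE.
have V10 k : valuation (pair_nat (pair_nat 10 k) 0) = f k.
  by rewrite /valuation !pairE /= !pairE.
rewrite !V10 !(E _ _ h0) !(E _ _ h1) !(E _ _ h2) !V /= (negPf h).
do 5![case: (pi1 a == _) => //].
case: (pi1 a == 6); first by rewrite eqb0 negbK.
case: (pi1 a == 7); first by rewrite eqb0.
case: (pi1 a == 8); first by rewrite eqb0 negbK.
case: (pi1 a == 9) => //.
case: pselect => [ex|no] /=; last first.
  by apply/eqP; apply: contrapT => no'; apply: no; exists m.
by apply/eqP; exact: projT2 (cid ex).
Qed.

Lemma fun_of_valuation : fun_of valuation = f.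
Proof. by apply: funext => k; rewrite /fun_of /valuation !pairE /= !pairE. Qed.

End Valuation.

Lemma univ_formula p e :
  univ (pair_nat (fcode p) (ecode e)) <-> forall f, holds f e p.
Proof.
split=> [h f|h g hg]; last by apply/(sat_formula p e hg).
have hs := valuation_sat f; have := h _ hs.
by move/(sat_formula p e hs); rewrite fun_of_valuation.
Qed.

(** * The tree of attempts to refute membership in the universal set *)

(* [s] lists, last value first, the first [L] values of a function *)
Definition look (L s k : nat) : nat := pi1 (iteri (L.-1 - k) (fun _ => pi2) s).

(* A node [pair_nat x (pair_nat L s)] is a finite sequence of length [L] trying
   to become a correct valuation with a nonzero value at [x]. *)
Definition tree_root (x : nat) : nat := pair_nat x (pair_nat 0 0).

Definition child (y i : nat) : nat :=
  pair_nat (pi1 y) (pair_nat (pi1 (pi2 y)).+1 (pair_nat i (pi2 (pi2 y)))).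

Definition node_look (y : nat) : nat -> nat :=
  look (pi1 (pi2 y)) (pi2 (pi2 y)).

(* Only the constraint number [pi1 L] is tested at length [L]: every constraint
   is tested at arbitrarily large lengths. *)
Definition consistent (y : nat) : bool :=
  let L := pi1 (pi2 y) in
  (~~ available (node_look y) (pi1 L) L || constraint (node_look y) (pi1 L)) &&
  ((L <= pi1 y) || (node_look y (pi1 y) != 0)).

Lemma pr_child F G : primrec F -> primrec G ->
  primrec (fun x => child (F x) (G x)).
Proof. by move=> hF hG; rewrite /child; pr. Qed.

Lemma pr_node_look F G : primrec F -> primrec G ->
  primrec (fun x => node_look (F x) (G x)).
Proof.
move=> hF hG; rewrite /node_look /look; pr.
by apply: pr_iteri; pr.
Qed.

Lemma pr_enth F G : primrec F -> primrec G ->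
  primrec (fun x => enth (F x) (G x)).
Proof. by move=> hF hG; rewrite /enth; pr; apply: pr_iteri; pr. Qed.

Lemma pr_consistent : primrec consistent.
Proof.
pose n y := pi1 (pi1 (pi2 y)); have hn : primrec n by rewrite /n; pr.
have h0 : primrec (fun y => node_look y (qval (n y))).
  by apply: pr_node_look; rewrite /qval; pr.
have h1 : primrec (fun y => node_look y (qsub (n y))).
  by apply: pr_node_look; rewrite /qsub; pr.
have h2 : primrec (fun y => node_look y (qsub1 (n y))).
  by apply: pr_node_look; rewrite /qsub1; pr.
have h3 : primrec (fun y => node_look y (qsub2 (n y))).
  by apply: pr_node_look; rewrite /qsub2; pr.
have q4 : primrec (fun y => qapp (node_look y) (n y)) by rewrite /qapp; pr.
have h4 := pr_node_look pr_id q4.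
have h5 : primrec (fun y => node_look y (qall (n y))).
  by apply: pr_node_look; rewrite /qall; pr.
have q6 : primrec (fun y => qwit (node_look y) (n y)) by rewrite /qwit; pr.
have h6 := pr_node_look pr_id q6.
have hc : primrec (fun y => constraint (node_look y) (n y)).
  by rewrite /constraint; pr; apply: pr_enth; pr.
have ha : primrec (fun y => available (node_look y) (n y) (pi1 (pi2 y))).
  by rewrite /available; pr; rewrite /qval /qsub /qsub1 /qsub2 /qall; pr.
have hx : primrec (fun y => node_look y (pi1 y)) by apply: pr_node_look; pr.
by rewrite /consistent; pr.
Qed.

Inductive wf (y : nat) : Prop :=
  wf_intro : (forall i, consistent (child y i) -> wf (child y i)) -> wf y.

Definition history (g : nat -> nat) (L : nat) : nat :=
  iteri L (fun i r => pair_nat (g i) r) 0.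

Lemma look_history g L k : k < L -> look L (history g L) k = g k.
Proof.
have H j d : iteri d (fun _ => pi2) (history g (j + d)) = history g j.
  elim: d => [|d IH]; first by rewrite addn0.
  by rewrite iteri_pi2S addnS /= pi2_pair IH.
move=> hk; rewrite /look.
have -> : history g L = history g (k.+1 + (L.-1 - k)) by congr history; lia.
by rewrite H /= pi1_pair.
Qed.

Definition branch (x : nat) (g : nat -> nat) (L : nat) : nat :=
  pair_nat x (pair_nat L (history g L)).

Lemma branchS x g L : branch x g L.+1 = child (branch x g L) (g L).
Proof. by rewrite /child /branch !pairE. Qed.

Lemma consistent_branch x g L : consistent (branch x g L) =
  (~~ available g (pi1 L) L || constraint g (pi1 L)) &&
  ((L <= x) || (g x != 0)).
Proof.
have H k : k < L -> node_look (branch x g L) k = g k.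
  by rewrite /node_look /branch !pairE; apply: look_history.
rewrite /consistent; set g' := node_look _ in H *.
rewrite /branch !pairE; congr andb; last first.
  by case: leqP => // /H ->.
have [ha|ha] := boolP (available g (pi1 L) L).
  by have [-> ->] := constraint_ext H ha.
have [ha'|//] := boolP (available g' (pi1 L) L).
have H' k : k < L -> g k = g' k by move=> /H.
by have [h] := constraint_ext H' ha'; rewrite h in ha.
Qed.

(** A correct valuation that is nonzero at [x] is an infinite branch of consistent nodes.
    Conversely, an ill-founded node has an ill-founded consistent child, and following such children
    yields a correct valuation. *)
Lemma univ_wf x : univ x <-> wf (tree_root x).
Proof.
split=> [hx|hw g hg]; last first.
  apply: contrapT => gx.
  suff H y : wf y -> forall L, y <> branch x g L by exact: H hw 0 erefl.
  elim=> {}y _ IH L e; subst y; apply: (IH (g L)) (L.+1) _.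
    rewrite -branchS consistent_branch hg orbT /=.
    by apply/orP; right; apply/eqP.
  by rewrite branchS.
apply: contrapT => nw.
have /choice[c hc] : forall y, exists i, ~ wf y ->
    consistent (child y i) /\ ~ wf (child y i).
  move=> y; have [hy|hy] := pselect (wf y); first by exists 0.
  apply: contrapT => no; apply: hy; constructor => i hi.
  by apply: contrapT => hn; apply: no; exists i.
pose s := fix s L := if L is L'.+1 then child (s L') (c (s L')) else tree_root x.
pose g L := c (s L).
have sE L : s L = branch x g L.
  by elim: L => [|L IH] //; rewrite branchS -IH.
have bad L : ~ wf (s L) by elim: L => [|L /hc[]].
have hL L : 0 < L -> consistent (branch x g L).
  by case: L => // L _; rewrite -sE; have [] := hc _ (bad L).
have hg : sat g.
  move=> n.
  (* The length [pair_nat n M.+1] tests constraint [n] and exceeds every argument at which this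
     constraint reads [g]. *)
  pose M := qval n + qsub n + qsub1 n + qsub2 n + qapp g n + qall n + qwit g n.
  have : available g n (pair_nat n M.+1).
    by have := pair_bound n M.+1; rewrite /available /M; lia.
  have : 0 < pair_nat n M.+1 by have := pair_bound n M.+1; lia.
  by move=> /hL; rewrite consistent_branch pi1_pair => /andP[/orP[/negP|]].
have : 0 < x.+1 by []. move=> /hL;
  rewrite consistent_branch ltnn /= => /andP[_].
by rewrite hx.
Qed.

(** * Comparing the stages at which elements enter the universal set *)

Definition dominating (S : nat -> nat -> Prop) (z z' : nat) : Prop :=
  forall i, consistent (child z i) ->
    exists j, consistent (child z' j) /\ S (child z i) (child z' j).

(* The least relation closed under [dominating]; the sets in this definition are
   given by the zeros of functions, to make it visibly Pi^1_1. For [y] in the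
   well-founded part it says that the rank of [y] is at most that of [y']. *)
Definition rank_le (y y' : nat) : Prop :=
  forall X : nat -> nat,
    (forall z z', dominating (fun a b => X (pair_nat a b) = 0) z z' ->
       X (pair_nat z z') = 0) -> X (pair_nat y y') = 0.

Definition rank_lt (y y' : nat) : Prop :=
  exists j, consistent (child y' j) /\ rank_le y (child y' j).

Lemma rank_le_intro y y' : dominating rank_le y y' -> rank_le y y'.
Proof.
by move=> h X hX; apply: (hX) => i /h[j [hj /(_ X hX)]]; exists j.
Qed.

(** An arbitrary relation is the zero set of its negated characteristic function. *)
Lemma rank_le_ind (S : nat -> nat -> Prop) :
  (forall z z', dominating S z z' -> S z z') ->
  forall y y', rank_le y y' -> S y y'.
Proof.
move=> hS y y' /(_ (fun q => ~~ `[< S (pi1 q) (pi2 q) >])).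
rewrite !pairE; case: asboolP => //= _ h; apply: contrapT => _.
have // : true = 0 :> nat; apply: h => z z' h; rewrite !pairE.
case: asboolP => // no; case: no; apply: hS => i /h[j []].
by rewrite !pairE; case: asboolP => // ? ? _; exists j.
Qed.

(** The least closed relation is a fixed point, since [dominating rank_le] is itself closed. *)
Lemma rank_le_elim y y' : rank_le y y' -> dominating rank_le y y'.
Proof.
move: y y'; apply: rank_le_ind => z z' h i /h[j [hj hij]].
by exists j; split=> //; apply: rank_le_intro.
Qed.

Lemma rank_le_wf y y' : rank_le y y' -> wf y.
Proof.
move: y y'; apply: rank_le_ind => z z' h; constructor => i /h.
by move=> [j []].
Qed.

Lemma rank_le_refl y : wf y -> rank_le y y.
Proof.
by elim=> {}y _ IH; apply: rank_le_intro => i hi; exists i; split=> //;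
  apply: IH.
Qed.

Lemma rank_le_trans y2 y1 y3 : rank_le y1 y2 -> rank_le y2 y3 -> rank_le y1 y3.
Proof.
move=> h; move: y1 y2 h y3; apply: rank_le_ind => y1 y2 h y3 h23.
apply: rank_le_intro => i /h[j [hj IH]].
have [k [hk hjk]] := rank_le_elim h23 hj.
by exists k; split=> //; apply: IH.
Qed.

Lemma rank_le_child y z i :
  consistent (child z i) -> rank_le y (child z i) -> rank_le y z.
Proof.
move=> hi h; have hy := rank_le_wf h; elim: hy z i hi h => {}y _ IH z i hi h.
apply: rank_le_intro => k hk; have [j [hj hkj]] := rank_le_elim h hk.
by exists i; split=> //; apply: IH hkj.
Qed.

Lemma rank_lt_le y z : rank_lt y z -> rank_le y z.
Proof. by move=> [i [hi]]; apply: rank_le_child. Qed.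

(** Induction on the well-founded node [u]: a child of [u] matched by no child of [v] lies strictly
    above all children of [v], hence at least as high as [v]. *)
Lemma rank_le_or_lt y z : wf y \/ wf z -> rank_le y z \/ rank_lt z y.
Proof.
have H u : wf u -> forall v, rank_le u v \/ rank_lt v u.
  elim=> {}u hu IH v; have [|no] := pselect (rank_lt v u); first by right.
  left; apply: rank_le_intro => i hi; apply: contrapT => ni.
  apply: no; exists i; split=> //; apply: rank_le_intro => j hj.
  have [h|] := IH i hi (child v j); first by case: ni; exists j.
  by move=> [k [hk hjk]]; exists k.
case=> [/H|hz]; first exact.
have [|no] := pselect (rank_lt z y); first by right.
left; apply: rank_le_intro => i hi.
have [h|[j [hj hij]]] := H z hz (child y i); last by exists j.
by case: no; exists i.
Qed.

Lemma rank_le_not_lt y z : rank_le y z -> ~ rank_lt z y.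
Proof.
have irr u : wf u -> forall i, consistent (child u i) -> ~ rank_le u (child u i).
  elim=> {}u _ IH i hi /rank_le_elim/(_ i hi)[j [hj]].
  exact: IH.
move=> h [i [hi /(rank_le_trans h)]]; exact: irr (rank_le_wf h) _ hi.
Qed.

Definition stage_le (x y : nat) : Prop := rank_le (tree_root x) (tree_root y).
Definition stage_lt (x y : nat) : Prop := rank_lt (tree_root x) (tree_root y).

Lemma stage_le_refl x : univ x -> stage_le x x.
Proof. by move=> /univ_wf; apply: rank_le_refl. Qed.

Lemma stage_le_univ x y : stage_le x y -> univ x.
Proof. by move=> /rank_le_wf/univ_wf. Qed.

Lemma stage_le_trans y x z : stage_le x y -> stage_le y z -> stage_le x z.
Proof. exact: rank_le_trans. Qed.

Lemma stage_lt_le x y : stage_lt x y -> stage_le x y.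
Proof. exact: rank_lt_le. Qed.

(** The prewellordering property of Pi^1_1: once one of the two numbers is known to be in [univ],
    the comparison and its negation are both Pi^1_1. *)
Lemma not_stage_le x y : univ x \/ univ y -> ~ stage_le x y <-> stage_lt y x.
Proof.
rewrite !univ_wf => /rank_le_or_lt h; split; first by case: h.
by move=> ? /rank_le_not_lt.
Qed.

Lemma stage_le_total x y : univ x -> univ y -> stage_le x y \/ stage_le y x.
Proof.
move=> hx hy; have [|/not_stage_le h] := pselect (stage_le x y); first by left.
by right; apply/stage_lt_le/h; left.
Qed.

Lemma pi_rank_le : Pi (fun _ z => rank_le (pi1 z) (pi2 z)).
Proof.
have hc : primrec (fun x => consistent x) by exact: pr_consistent.
have h : Pi (fun _ x => forall X : nat -> nat,
    (exists z, exists z',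
      (forall i, consistent (child z i) -> exists j,
         consistent (child z' j) /\ X (pair_nat (child z i) (child z' j)) = 0)
      /\ X (pair_nat z z') <> 0) \/ X x = 0).
  apply: pi_allf; apply: pi_or; last exact: pi_app0 pr_id.
  apply: pi_ex; apply: pi_ex; apply: pi_and; last by apply: pi_app; pr.
  apply: pi_all; apply: pi_imp.
    by apply: (pr_comp hc); apply: pr_child; pr.
  apply: pi_ex; apply: pi_and.
    by apply: pi_bool; apply: (pr_comp hc); apply: pr_child; pr.
  by apply: pi_app0; pr; apply: pr_child; pr.
apply: pi_iff h => _ x; split=> h X.
- move=> hX; case: (h X) => [[z [z' [hz nz]]]|]; last by rewrite pair_pi.
  by case: nz; apply: hX.
- have [|no] := pselect (X x = 0); first by right.
  left; apply: contrapT => no'; apply: no.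
  rewrite -(pair_pi x); apply: h => z z' hz; apply: contrapT => nz.
  by apply: no'; exists z, z'.
Qed.

Lemma pi_rank_le2 F G : primrec F -> primrec G ->
  Pi (fun _ x => rank_le (F x) (G x)).
Proof.
move=> hF hG; have := pi_comp pi_rank_le (pr_pair hF hG).
by apply: pi_iff => _ x; rewrite !pairE.
Qed.

Lemma pi_stage_le F G : primrec F -> primrec G ->
  Pi (fun _ x => stage_le (F x) (G x)).
Proof. by move=> hF hG; apply: pi_rank_le2; rewrite /tree_root; pr. Qed.

Lemma pi_stage_lt F G : primrec F -> primrec G ->
  Pi (fun _ x => stage_lt (F x) (G x)).
Proof.
move=> hF hG; have hF1 := pr_comp hF pr_pi1; have hG1 := pr_comp hG pr_pi1.
have hc : primrec (fun z => child (tree_root (G (pi1 z))) (pi2 z)).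
  by apply: pr_child; rewrite /tree_root; pr.
apply: pi_ex; apply: pi_and; first exact: pi_bool (pr_comp pr_consistent hc).
by apply: pi_rank_le2; rewrite // /tree_root; pr.
Qed.

Lemma pi_univ F : primrec F -> Pi (fun _ x => univ (F x)).
Proof.
move=> hF; have := pi_stage_le hF hF; apply: pi_iff => _ x.
by split=> [/stage_le_univ//|/stage_le_refl].
Qed.

(** * Kleene's O is complete *)

Lemma run_primrec F : primrec F -> exists c, forall x, run c x (F x).
Proof.
elim=> {F} [||||F G _ [c hc] _ [d hd]|F G _ [c hc] _ [d hd]|F G _ [c hc] _ [d hd]].
- by exists PZero.
- by exists PSucc.
- by exists PFst.
- by exists PSnd.
- by exists (PPair c d) => x; exists (F x), (G x).
- by exists (PComp c d) => x; exists (G x).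
- exists (PRec c d) => x; rewrite /= /pi1 /pi2;
    case: (Cantor.of_nat x) => a n /=.
  exists (fun m => iteri m (fun i r => G (pair_nat a (pair_nat i r))) (F a)).
  by split=> // i _; apply: hd.
Qed.

Lemma run_inj c x y y' : run c x y -> run c x y' -> y = y'.
Proof.
elim: c x y y' => [||||c IHc d IHd|c IHc d IHd|c IHc d IHd|c IHc] x y y' /=;
  try by move=> -> ->.
- by move=> [a [b [ha hb ->]]] [a' [b' [/(IHc _ _ _ ha) <- /(IHd _ _ _ hb) <- ->]]].
- by move=> [z hz h] [z' /(IHd _ _ _ hz) <- /(IHc _ _ _ h)].
- case: (Cantor.of_nat x) => a n [h [h0 hS ->]] [h' [h0' hS' ->]].
  have H i : i <= n -> h i = h' i.
    elim: i => [|i IH] hi; first exact: IHc h0 h0'.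
    by have := hS i hi; rewrite (IH (ltnW hi)) => /IHd; apply; apply: hS'.
  exact: H.
- move=> [h0 hlt] [h0' hlt']; case: (ltngtP y y') => // h.
  + by have [k /IHc /(_ h0)] := hlt' _ h.
  + by have [k /IHc /(_ h0')] := hlt _ h.
Qed.

Lemma godel_inj : injective godel.
Proof.
elim=> [||||c IHc d IHd|c IHc d IHd|c IHc d IHd|c IHc];
  case=> [||||c' d'|c' d'|c' d'|c'] //= h; try lia.
- have /pair_inj[/IHc -> /IHd ->] // : pair_nat (godel c) (godel d) =
    pair_nat (godel c') (godel d') by lia.
- have /pair_inj[/IHc -> /IHd ->] // : pair_nat (godel c) (godel d) =
    pair_nat (godel c') (godel d') by lia.
- have /pair_inj[/IHc -> /IHd ->] // : pair_nat (godel c) (godel d) =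
    pair_nat (godel c') (godel d') by lia.
- by congr PMu; apply: IHc; lia.
Qed.

Lemma phi_inj e x y y' : phi e x y -> phi e x y' -> y = y'.
Proof. by move=> [c <- h] [c' /godel_inj -> /(run_inj h)]. Qed.

Fixpoint pconst (a : nat) : prog :=
  if a is a'.+1 then PComp PSucc (pconst a') else PZero.

Definition partial_prog (c : prog) (a : nat) : prog :=
  PComp c (PPair (pconst a) (PPair PFst PSnd)).

Lemma run_pconst a x : run (pconst a) x a.
Proof. by elim: a => //= a IH; exists a. Qed.

Lemma run_partial c a x y :
  run c (pair_nat a x) y -> run (partial_prog c a) x y.
Proof.
move=> h; exists (pair_nat a x) => //=; exists a, x; split=> //.
  exact: run_pconst.
by exists (pi1 x), (pi2 x); rewrite pair_pi.
Qed.

(** The index of [partial_prog], spelled out arithmetically to make it primitive recursive in both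
    arguments. [PPair PFst PSnd] is the identity program. *)
Definition smn (k a : nat) : nat :=
  4 * pair_nat k (4 * pair_nat (godel (pconst a)) (godel (PPair PFst PSnd)) + 4)
  + 5.

Lemma smnE c a : smn (godel c) a = godel (partial_prog c a).
Proof. by []. Qed.

Lemma pr_godel_pconst F : primrec F -> primrec (fun x => godel (pconst (F x))).
Proof.
move=> hF.
apply: (@pr_ext (fun x => iteri (F x) (fun _ r => 4 * pair_nat 1 r + 5) 0)).
  by move=> x; elim: (F x) => //= n ->.
by apply: pr_iteri; pr.
Qed.

Lemma pr_smn F G : primrec F -> primrec G -> primrec (fun x => smn (F x) (G x)).
Proof. by move=> hF hG; rewrite /smn; pr; apply: pr_godel_pconst. Qed.

Lemma phi_smn c a x y : run c (pair_nat a x) y -> phi (smn (godel c) a) x y.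
Proof. by move=> /run_partial h; exists (partial_prog c a). Qed.

Lemma recursion_theorem (D : nat -> nat -> nat) :
  primrec (fun z => D (pi1 z) (pi2 z)) ->
  exists c, forall x, run c x (D (godel c) x).
Proof.
move=> hD.
have [d hd] : exists d, forall x, run d x (D (smn (pi1 x) (pi1 x)) (pi2 x)).
  apply: run_primrec; apply: (pr_app2 hD); last exact: pr_pi2.
  by apply: pr_smn; pr.
exists (partial_prog d (godel d)) => x; apply: run_partial.
by have := hd (pair_nat (godel d) x); rewrite !pairE smnE.
Qed.

(* The limit notation with index [smn q (pair_nat a y)], for the right [q]: its
   fundamental sequence starts at [a] and adds the notations of the children of
   the node [y] one after the other. *)
Definition notation_of (q a y : nat) : nat := 3 * 5 ^ smn q (pair_nat a y).

Definition fund_seq (q a y k : nat) : nat :=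
  iteri k (fun i r => if consistent (child y i) then notation_of q r (child y i)
                      else 2 ^ r) a.

Lemma pow_2_neq_3_5 a e : 2 ^ a <> 3 * 5 ^ e.
Proof.
move=> h; have : 3 %| 2 ^ a by rewrite h dvdn_mulr.
by rewrite Euclid_dvdX.
Qed.

Lemma pow_3_5_inj e e' : 3 * 5 ^ e = 3 * 5 ^ e' -> e = e'.
Proof. by move=> /eqP; rewrite eqn_pmul2l // eqn_exp2l // => /eqP. Qed.

Section Completeness.
Variable q : nat.
Hypothesis hq : forall a y k,
  phi (smn q (pair_nat a y)) k (fund_seq q a y k).

Lemma notation_wf y : wf y -> forall a, kleeneO a ->
  kleeneO (notation_of q a y) /\ ltO a (notation_of q a y).
Proof.
elim=> {}y _ IH a ha.
have hO k : kleeneO (fund_seq q a y k).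
  elim: k => [|k hk] //=; case: ifP => [/IH/(_ _ hk)[]//|_].
  exact: O_succ.
have hlt k : ltO (fund_seq q a y k) (fund_seq q a y k.+1).
  rewrite /= -/(fund_seq q a y k); case: ifP => [/IH/(_ _ (hO k))[]//|_].
  exact: ltO_succ.
split; first exact: O_lim (hq a y) hO hlt.
exact: (ltO_lim 0 (hq a y) hO hlt).
Qed.

(** All terms of the fundamental sequence of a notation in O are in O, and for a consistent child
    [i] the term [i.+1] is a notation of that child. *)
Lemma wf_notation a y : kleeneO (notation_of q a y) -> wf y.
Proof.
move e : (notation_of q a y) => c hc;
  elim: hc a y e => {c} [|b _ _|e g hg _ IH _] a y.
- rewrite /notation_of -(expn0 2) => h;
    exact: (False_ind _ (pow_2_neq_3_5 (esym h))).
- rewrite /notation_of => h; exact: (False_ind _ (pow_2_neq_3_5 (esym h))).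
- rewrite /notation_of => /pow_3_5_inj ee; subst e; constructor => i hi.
  have E k : g k = fund_seq q a y k by apply: phi_inj (hg k) (hq a y k).
  apply: (IH i.+1 (fund_seq q a y i)).
  by rewrite E /= hi.
Qed.

End Completeness.

(** The fundamental sequences mention the index of the program that computes them, so the recursion
    theorem supplies it. The starting point 1 is the notation of zero. *)
Lemma kleeneO_complete :
  exists h, primrec h /\ forall x, univ x <-> kleeneO (h x).
Proof.
have [c hc] : exists c, forall z,
    run c z (fund_seq (godel c) (pi1 (pi1 z)) (pi2 (pi1 z)) (pi2 z)).
  apply: (@recursion_theorem
    (fun q z => fund_seq q (pi1 (pi1 z)) (pi2 (pi1 z)) (pi2 z))).
  have hch : primrec (fun z =>
      child (pi2 (pi1 (pi2 (pi1 z)))) (pi1 (pi2 z))) by apply: pr_child; pr.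
  rewrite /fund_seq; apply: pr_iteri; pr.
  - exact: (pr_comp pr_consistent hch).
  - by rewrite /notation_of; pr; apply: pr_smn; pr.
have hq a y k : phi (smn (godel c) (pair_nat a y)) k (fund_seq (godel c) a y k).
  by apply: phi_smn; have := hc (pair_nat (pair_nat a y) k); rewrite !pairE.
exists (fun x => notation_of (godel c) 1 (tree_root x)); split.
  by rewrite /notation_of /tree_root; pr; apply: pr_smn; pr.
move=> x; rewrite univ_wf; split; last exact: wf_notation.
by move=> /(notation_wf hq)/(_ 1 O_zero)[].
Qed.

Local Open Scope classical_set_scope.

(** * Finite approximations of the measure *)

(** Divided by [2 ^ N], this is the measure of the clopen set that [p] determines at length [N]. *)
Fixpoint cnt (N : nat) (p : pred string) : nat :=
  if N is N'.+1 then
    cnt N' (fun t => p (false :: t)) + cnt N' (fun t => p (true :: t))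
  else p [::].

Lemma cnt_mono N (p q : pred string) :
  (forall t, size t = N -> p t -> q t) -> cnt N p <= cnt N q.
Proof.
elim: N p q => [|N IH] p q h /=.
  by have := h [::] erefl; case: (p _); case: (q _) => // /(_ isT).
by apply: leq_add; apply: IH => t ht; apply: h; rewrite /= ht.
Qed.

Lemma eq_cnt N (p q : pred string) :
  (forall t, size t = N -> p t = q t) -> cnt N p = cnt N q.
Proof.
by move=> h; apply/eqP; rewrite eqn_leq !cnt_mono // => t /h ->.
Qed.

Lemma cntU N (p q : pred string) :
  cnt N (fun t => p t || q t) <= cnt N p + cnt N q.
Proof.
elim: N p q => [|N IH] p q /=; first by case: (p _); case: (q _).
by rewrite addnACA leq_add.
Qed.

Lemma cnt_disjointU N (p q : pred string) :
  (forall t, size t = N -> ~~ (p t && q t)) ->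
  cnt N (fun t => p t || q t) = cnt N p + cnt N q.
Proof.
elim: N p q => [|N IH] p q h /=.
  by have := h [::] erefl; case: (p _); case: (q _).
by rewrite addnACA !IH // => t ht; apply: h; rewrite /= ht.
Qed.

Lemma cnt0 N : cnt N pred0 = 0.
Proof. by elim: N => //= N ->. Qed.

Lemma cntT N : cnt N predT = 2 ^ N.
Proof. by elim: N => //= N ->; rewrite expnS mul2n addnn. Qed.

Lemma cnt_le_max N p : cnt N p <= 2 ^ N.
Proof. by rewrite -cntT; apply: cnt_mono. Qed.

Lemma cnt_prefix N s : size s <= N -> cnt N (prefix s) = 2 ^ (N - size s).
Proof.
elim: s N => [|b s IH] N hN.
  by rewrite subn0 -cntT; apply: eq_cnt => t _; rewrite prefix0s.
case: N hN => // N /= /IH e; rewrite subSS.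
have e1 : cnt N (fun t => prefix (b :: s) (b :: t)) = 2 ^ (N - size s).
  by rewrite -e; apply: eq_cnt => t _; rewrite prefix_cons eqxx.
have e2 : cnt N (fun t => prefix (b :: s) (~~ b :: t)) = 0.
  by rewrite -(cnt0 N); apply: eq_cnt => t _; rewrite prefix_cons; case: (b).
by case: b e1 e2 => -> ->; rewrite ?addn0.
Qed.

Lemma cnt_take N K (p : pred string) :
  cnt (N + K) (fun t => p (take N t)) = 2 ^ K * cnt N p.
Proof.
elim: N p => [|N IH] p; last first.
  rewrite addSn /= (IH (fun u => p (false :: u))) (IH (fun u => p (true :: u))).
  by rewrite mulnDr.
rewrite add0n (@eq_cnt _ _ (fun=> p [::])); last by move=> t _; rewrite take0.
rewrite /=; case: (p [::]); first by rewrite muln1 -cntT.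
by rewrite muln0 -(cnt0 K).
Qed.

Lemma cnt_has (T : Type) N (P : T -> pred string) (r : seq T) :
  cnt N (fun t => has (P^~ t) r) <= \sum_(i <- r) cnt N (P i).
Proof.
elim: r => [|i r IH] /=; first by rewrite big_nil -[leqRHS](cnt0 N).
rewrite big_cons; apply: leq_trans (cntU _ _ _) _.
by rewrite leq_add2l.
Qed.

Lemma sum_double n (h : nat -> nat) :
  \sum_(c < n.*2) h c = \sum_(c < n) (h c.*2 + h c.*2.+1).
Proof.
elim: n => [|n IH]; first by rewrite !big_ord0.
by rewrite doubleS !big_ord_recr /= IH addnA.
Qed.

(** The strings of length [N] are those with codes from [2 ^ N - 1] to [2 ^ N.+1 - 2], so counting
    is a bounded sum and hence primitive recursive. *)
Lemma cnt_code N (p : pred string) :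
  cnt N p = \sum_(c < 2 ^ N) p (sdec (2 ^ N - 1 + c)).
Proof.
elim: N p => [|N IH] p; first by rewrite big_ord_recl big_ord0 addn0.
rewrite /= !IH expnS mul2n.
rewrite (@sum_double (2 ^ N) (fun c => p (sdec ((2 ^ N).*2 - 1 + c)))).
rewrite -big_split /=; apply: eq_bigr => c _.
have h : 0 < 2 ^ N by rewrite expn_gt0.
congr (nat_of_bool (p _) + nat_of_bool (p _));
  apply: scode_inj; rewrite /= !sdecK; lia.
Qed.

Definition covers (D : seq string) : pred string :=
  fun t => has (fun s => prefix s t) D.

Lemma covers_sub D D' t : {subset D <= D'} -> covers D t -> covers D' t.
Proof. by move=> h /hasP[s /h hs st]; apply/hasP; exists s. Qed.

Lemma covers_take D N t : all (fun s => size s <= N) D ->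
  covers D (take N t) = covers D t.
Proof.
move=> /allP h; apply: eq_in_has => s /h hs.
by rewrite !prefixE take_takel.
Qed.

Lemma cnt_covers_le N D : all (fun s => size s <= N) D ->
  cnt N (covers D) <= \sum_(s <- D) 2 ^ (N - size s).
Proof.
move=> /allP h; apply: leq_trans (cnt_has _ _ _) _.
by rewrite !big_seq leq_sum // => s /h /cnt_prefix ->.
Qed.

Lemma prefix_total (s t u : string) :
  prefix s u -> prefix t u -> prefix s t || prefix t s.
Proof.
rewrite !prefixE => /eqP hs /eqP ht.
have [h|/ltnW h] := leqP (size s) (size t); apply/orP; [left|right].
  by rewrite -ht take_takel // hs.
by rewrite -hs take_takel // ht.
Qed.

Lemma cnt_covers_antichain N D : all (fun s => size s <= N) D -> uniq D ->
  {in D &, forall s t, prefix s t -> s = t} ->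
  cnt N (covers D) = \sum_(s <- D) 2 ^ (N - size s).
Proof.
elim: D => [|s D IH] /=; first by rewrite big_nil -[RHS](cnt0 N).
move=> /andP[hs hD] /andP[sD uD] anti; rewrite big_cons -IH //; last first.
  by move=> u v hu hv; apply: anti; rewrite inE ?hu ?hv orbT.
rewrite -(cnt_prefix hs); apply: cnt_disjointU => t ht.
apply/negP => /andP[st /hasP[u uD' ut]].
have su : s = u.
  by case/orP: (prefix_total st ut) => h; [|apply/esym];
    apply: anti h; rewrite inE ?eqxx ?uD' ?orbT.
by rewrite su uD' in sD.
Qed.

(* [V] generates an open set of measure at most [2 ^- m] *)
Definition light (m : nat) (V : set string) : Prop :=
  forall (D : seq string) N, (forall s, s \in D -> V s) ->
    all (fun s => size s <= N) D -> cnt N (covers D) * 2 ^ m <= 2 ^ N.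

Lemma light_sub m V V' : V' `<=` V -> light m V -> light m V'.
Proof. by move=> h hV D N hD; apply: hV => s /hD /h. Qed.

Lemma exists_size_bound (D : seq string) : exists N, all (fun s => size s <= N) D.
Proof.
exists (\max_(s <- D) size s); apply/allP => s hs.
exact: leq_bigmax_seq.
Qed.

Lemma initialP (X : cantor) n : initial (mkseq X n) X.
Proof. by rewrite /initial size_mkseq. Qed.

Lemma prefix_initial s X n :
  prefix s (mkseq X n) <-> initial s X /\ size s <= n.
Proof.
split=> [h|[e h]].
- have hn : size s <= n by have := size_prefix h; rewrite size_mkseq.
  split=> //; move: h; rewrite prefixE => /eqP <-.
  by rewrite /initial -map_take take_iota (minn_idPl _) // size_map size_iota.
- by rewrite prefixE -map_take take_iota (minn_idPl h); apply/eqP/esym.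
Qed.

(** * Compactness of Cantor space *)

Lemma path_of_strings (P : nat -> string) (b : nat -> bool) :
  (forall k, P k.+1 = rcons (P k) (b k)) -> exists X, forall k, initial (P k) X.
Proof.
move=> hP; exists (fun i => nth false (P i.+1) i) => k.
have hs j : size (P j) = size (P 0) + j.
  by elim: j => [|j IH]; rewrite ?addn0 // hP size_rcons IH addnS.
have pre j d : prefix (P j) (P (j + d)).
  elim: d => [|d IH]; first by rewrite addn0 prefix_refl.
  by rewrite addnS hP; apply: prefix_trans IH (prefix_rcons _ _).
have agree j l i : i < size (P j) -> j <= l -> nth false (P l) i = nth false (P j) i.
  move=> hi /subnKC <-; have := pre j (l - j); rewrite prefixE => /eqP e.
  by rewrite -[in RHS]e nth_take.
apply: (@eq_from_nth _ false) => [|i hi]; first by rewrite size_mkseq.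
rewrite nth_mkseq //; have [h|h] := leqP k i.+1; first by rewrite (agree k).
rewrite (agree i.+1 k) //; last exact: ltnW.
by move: (hs i.+1) => ->; rewrite addnS ltnS leq_addl.
Qed.

Definition barred (V : set string) (s : string) : Prop :=
  exists N (D : seq string), (forall v, v \in D -> V v) /\
    forall t, prefix s t -> N <= size t -> covers D t.

(** König's argument: if both one-letter extensions are barred then so is the string, hence an
    unbarred [s] extends to a path of unbarred strings. This path enters [V], and a string beyond
    that point is barred by a single element. *)
Lemma open_barred V s : open_of [set s] `<=` open_of V -> barred V s.
Proof.
move=> hs; apply: contrapT => ns.
have /choice[c hc] : forall t, exists b, ~ barred V t -> ~ barred V (rcons t b).
  move=> t; apply: contrapT => /forallNP no.
  have B b : barred V (rcons t b).
    by apply: contrapT => nb; apply: (no b).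
  apply: (no true) => nt; case: nt.
  have [N0 [D0 [V0 h0]]] := B false; have [N1 [D1 [V1 h1]]] := B true.
  exists (maxn (size t).+1 (maxn N0 N1)), (D0 ++ D1); split.
    by move=> v; rewrite mem_cat => /orP[/V0|/V1].
  move=> u /prefixP[w ->]; rewrite !geq_max size_cat.
  case: w => [|b w] /=; first by lia.
  rewrite -cat_rcons -[_ + _]/(size t + size (b :: w)) -size_cat -cat_rcons.
  case: b => /and3P[_ hN0 hN1].
    have := h1 _ (prefix_prefix (rcons t true) w) hN1.
    by apply: covers_sub => v; rewrite mem_cat orbC => ->.
  have := h0 _ (prefix_prefix (rcons t false) w) hN0.
  by apply: covers_sub => v; rewrite mem_cat => ->.
pose P := fix P k := if k is k'.+1 then rcons (P k') (c (P k')) else s.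
have nP k : ~ barred V (P k) by elim: k => //= k /hc.
have [X hX] := @path_of_strings P (fun k => c (P k)) (fun=> erefl).
have [|v hv Vv] := hs X; first by exists s => //; exact: hX 0.
have hsz j : size (P j) = size s + j.
  by elim: j => [|j IH] /=; rewrite ?addn0 // size_rcons IH addnS.
apply: (nP (size v)); exists 0, [:: v]; split.
  by move=> u; rewrite inE => /eqP ->.
move=> t ht _; rewrite /covers /= orbF; apply: prefix_trans ht.
by rewrite (hX (size v)) prefix_initial hsz; split=> //; apply: leq_addl.
Qed.

Lemma open_sub_finite V (D : seq string) : open_of [set` D] `<=` open_of V ->
  exists N (D' : seq string), (forall v, v \in D' -> V v) /\
    forall t, N <= size t -> covers D t -> covers D' t.
Proof.
elim: D => [|s D IH] h; first by exists 0, [::].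
have [N0 [D0 [V0 h0]]] : barred V s.
  apply: open_barred => X [u hu /= e]; apply: h; exists u => //.
  by rewrite /= e inE eqxx.
have [|N1 [D1 [V1 h1]]] := IH.
  move=> X [u hu /= hD]; apply: h; exists u => //.
  by rewrite /= inE hD orbT.
exists (maxn N0 N1), (D0 ++ D1); split.
  by move=> v; rewrite mem_cat => /orP[/V0|/V1].
move=> t; rewrite geq_max => /andP[t0 t1] /orP[st|Dt].
  by apply: covers_sub (h0 _ st t0) => v; rewrite mem_cat => ->.
by apply: covers_sub (h1 _ t1 Dt) => v; rewrite mem_cat orbC => ->.
Qed.

(** * Light sets and the outer measure *)

Section Coin.
Variable R : realType.

Lemma sum_halves (D : seq string) N : all (fun s => size s <= N) D ->
  (\sum_(s <- D) (2 ^- size s : R) =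
   (\sum_(s <- D) 2 ^ (N - size s))%N%:R * 2 ^- N)%R.
Proof.
move=> /allP h; rewrite natr_sum mulr_suml !big_seq; apply: eq_bigr => s /h hs.
by rewrite natrX -{2}(subnK hs) exprD invfM mulrA divff ?mul1r // expf_neq0.
Qed.

(** The minimal strings [V'] of [V] generate the same open set and form an antichain, so that finite
    partial sums over [V'] are exact measures of clopen sets. *)
Lemma coin_le m V : light m V -> (coin R (open_of V) <= ((2 ^- m)%R : R)%:E)%E.
Proof.
move=> hV.
pose V' : set string := [set s | V s /\ forall t, V t -> prefix t s -> t = s].
apply: le_trans (_ : (\esum_(s in V') (2 ^- size s : R)%:E)%R <= _)%E.
  apply: ereal_inf_lbound; exists V' => //= X [s].
  have [n] := ubnP (size s); elim: n s => // n IH s hn hs Vs.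
  have [[t [Vt [ts ne]]]|no] :=
      pselect (exists t, V t /\ prefix t s /\ t <> s).
    have hts : size t < size s.
      rewrite ltn_neqAle size_prefix // andbT; apply/eqP => e.
      by move: ts; rewrite prefixE e take_size => /eqP/esym.
    apply: (IH t) => //; first exact: leq_trans hts _.
    by move: ts; rewrite hs prefix_initial => -[].
  exists s => //; split=> // t Vt ts; apply: contrapT => ne.
  by apply: no; exists t.
apply: ge_ereal_sup => _ [F [finF FV'] <-].
rewrite fsbig_finite //= sumEFin lee_fin.
set D := enum_fset (fset_set F).
have hD s : s \in D -> V' s.
  by rewrite /D -[s \in _]/(s \in fset_set F) in_fset_set // => /set_mem /FV'.
have [N hN] := exists_size_bound D.
rewrite (sum_halves hN) -cnt_covers_antichain //; first last.
- by move=> s t /hD[Vs _] /hD[_ ht] /(ht _ Vs).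
- exact: fset_uniq.
have := hV D N (fun s h => (hD s h).1) hN.
rewrite -(ler_nat R) natrM !natrX => h.
by rewrite ler_pdivrMr ?exprn_gt0 // mulrC ler_pdivlMr ?exprn_gt0.
Qed.

(** By compactness, any cover of the open set has a finite part covering the cylinders of [D];
    counting at a common length [N + K] then bounds the measure by the sum over this part. *)
Lemma coin_light m V :
  (coin R (open_of V) <= ((2 ^- m)%R : R)%:E)%E -> light m V.
Proof.
move=> h D N hD hN.
suff : (((cnt N (covers D))%:R * 2 ^- N : R)%:E <= coin R (open_of V))%E.
  move=> /le_trans/(_ h); rewrite lee_fin ler_pdivrMr ?exprn_gt0 //.
  rewrite mulrC ler_pdivlMr ?exprn_gt0 //.
  by rewrite -!natrX -natrM ler_nat.
apply: le_ereal_inf_tmp => _ [V' /= hV' <-].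
have [N' [D' [V'D hD']]] : exists N' (D' : seq string),
    (forall v, v \in D' -> V' v) /\
    forall t, N' <= size t -> covers D t -> covers D' t.
  apply: open_sub_finite; apply: subset_trans hV' => X [s hs /hD Vs].
  by exists s.
pose E := undup D'; have [M hM] := exists_size_bound E.
apply: (@le_trans _ _ ((\sum_(s <- E) (2 ^- size s : R))%R)%:E); last first.
  apply: esum_ge; exists [set` E].
    by split=> //= v; rewrite /= /E mem_undup; apply: V'D.
  rewrite -fsbig_seq ?undup_uniq // sumEFin.
  exact: lexx.
pose K := maxn N' M.
have hK : all (fun s => size s <= N + K) E.
  by apply/allP => s /(allP hM) /=; rewrite /K; lia.
have le : 2 ^ K * cnt N (covers D) <= \sum_(s <- E) 2 ^ (N + K - size s).
  apply: leq_trans (cnt_covers_le hK); rewrite -cnt_take.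
  apply: cnt_mono => t ht; rewrite covers_take // => Dt.
  have /hD' : N' <= size t by rewrite ht /K; lia.
  by move=> /(_ Dt); apply: covers_sub => v; rewrite mem_undup.
rewrite lee_fin (sum_halves hK).
have -> : ((cnt N (covers D))%:R * 2 ^- N =
           (2 ^ K * cnt N (covers D))%:R * 2 ^- (N + K) :> R)%R.
  by rewrite natrM natrX addnC exprD invfM mulrACA divff ?mul1r //.
by rewrite ler_pM2r ?invr_gt0 ?exprn_gt0 // ler_nat.
Qed.

End Coin.

(** * Enumerated pairs of strings *)

(* Every number [i] is [item e n t s] for unique [e], [n], [t], [s]; if [e] is an
   index of [W], then [i] is in [univ] when [(n, t, s)] is in [W]. *)
Definition item (e n : nat) (t s : string) : nat :=
  pair_nat (pi1 e)
    (pair_nat n (pair_nat (scode t) (pair_nat (scode s) (pi2 e)))).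

Definition idx (i : nat) : nat := pair_nat (pi1 i) (pi2 (pi2 (pi2 (pi2 i)))).
Definition lvl (i : nat) : nat := pi1 (pi2 i).
Definition tau (i : nat) : string := sdec (pi1 (pi2 (pi2 i))).
Definition sig (i : nat) : string := sdec (pi1 (pi2 (pi2 (pi2 i)))).

Lemma idx_item e n t s : idx (item e n t s) = e.
Proof. by rewrite /idx /item !pairE pair_pi. Qed.

Lemma lvl_item e n t s : lvl (item e n t s) = n.
Proof. by rewrite /lvl /item !pairE. Qed.

Lemma tau_item e n t s : tau (item e n t s) = t.
Proof. by rewrite /tau /item !pairE scodeK. Qed.

Lemma sig_item e n t s : sig (item e n t s) = s.
Proof. by rewrite /sig /item !pairE scodeK. Qed.

Lemma item_eta i : item (idx i) (lvl i) (tau i) (sig i) = i.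
Proof. by rewrite /item /idx /lvl /tau /sig !sdecK !(pairE, pair_pi). Qed.

Lemma size_sdec c : size (sdec c) <= c.
Proof. by rewrite -[leqRHS]sdecK size_scode. Qed.

Lemma size_tau i : size (tau i) <= i.
Proof.
apply: leq_trans (size_sdec _) _; apply: leq_trans (pi1_le _) _.
exact: leq_trans (pi2_le _) (pi2_le _).
Qed.

Lemma size_sig i : size (sig i) <= i.
Proof.
apply: leq_trans (size_sdec _) _; apply: leq_trans (pi1_le _) _.
by apply: leq_trans (pi2_le _) _; apply: leq_trans (pi2_le _) (pi2_le _).
Qed.

Lemma Pi11_index (T : Type) (code : T -> seq nat) (P : set T) :
  Pi11 code P -> exists a, forall x, P x <-> univ (pair_nat a (ecode (code x))).
Proof. by move=> [p hp]; exists (fcode p) => x; rewrite hp univ_formula. Qed.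

(** The second component of an index is the tail of the coded environment, which is 0 for three
    arguments. *)
Lemma Pi11_nss_index W : Pi11 code_nss W ->
  exists e, forall n t s, W (n, t, s) <-> univ (item e n t s).
Proof.
move=> /Pi11_index[a ha]; exists (pair_nat a 0) => n t s.
by rewrite ha /item !pairE.
Qed.

(** * Selections of items and their weight *)

Definition outs (P : nat -> Prop) (e m : nat) : set string :=
  [set s | exists i, [/\ P i, idx i = e, lvl i = m & sig i = s]].

(* The outputs of the items like [i] selected by [d] that apply to all the
   oracles extending [r] *)
Definition sel (d : string) (i : nat) (r : string) : seq string :=
  [seq sig j | j <- iota 0 (size d) &
     [&& nth false d j, idx j == idx i, lvl j == lvl i & prefix (tau j) r]].

(** The selected outputs have measure above [2 ^- lvl i]. Counting at length [size d] is exact,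
    because a selected [j] is below [size d] and bounds the length of [sig j]. *)
Definition heavy (d : string) (i : nat) (r : string) : bool :=
  2 ^ size d < cnt (size d) (covers (sel d i r)) * 2 ^ lvl i.

Lemma selP d i r s : reflect
  (exists j, [/\ nth false d j, idx j = idx i, lvl j = lvl i,
                 prefix (tau j) r & sig j = s]) (s \in sel d i r).
Proof.
apply: (iffP mapP) => -[j].
  rewrite mem_filter => /andP[/and4P[dj /eqP hj /eqP lj tj] _] ->.
  by exists j.
move=> [dj hj lj tj <-]; exists j => //.
rewrite mem_filter dj hj lj tj !eqxx mem_iota /= add0n ltnNge.
by apply/negP => h; rewrite nth_default in dj.
Qed.

Lemma nth_size (d : string) j : nth false d j -> j < size d.
Proof. by rewrite ltnNge => dj; apply/negP => h; rewrite nth_default in dj. Qed.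

Lemma size_sel d i r : all (fun s => size s <= size d) (sel d i r).
Proof.
apply/allP => s /selP[j [/nth_size dj _ _ _ <-]].
exact: leq_trans (size_sig j) (ltnW dj).
Qed.

Lemma cnt_covers_scale N K D : all (fun s => size s <= N) D ->
  cnt (N + K) (covers D) = 2 ^ K * cnt N (covers D).
Proof.
by move=> h; rewrite -cnt_take; apply: eq_cnt => t _; rewrite covers_take.
Qed.

Lemma heavy_mono d d' i r r' : size d <= size d' ->
  (forall j, nth false d j -> nth false d' j) -> prefix r r' ->
  heavy d i r -> heavy d' i r'.
Proof.
move=> hs hd hr; rewrite /heavy -(subnKC hs); set K := size d' - size d.
have le : 2 ^ K * cnt (size d) (covers (sel d i r)) <=
          cnt (size d + K) (covers (sel d' i r')).
  rewrite -cnt_covers_scale ?size_sel //; apply: cnt_mono => t _.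
  apply: covers_sub => s /selP[j [dj ij lj tj sj]]; apply/selP; exists j.
  by split=> //; [exact: hd|exact: prefix_trans tj hr].
move=> h;
  apply: leq_trans (_ : 2 ^ K * cnt (size d) (covers (sel d i r)) * 2 ^ lvl i <= _).
  by rewrite addnC expnD -mulnA ltn_pmul2l // expn_gt0.
by rewrite leq_mul2r le orbT.
Qed.

(** The string [tau j] is no longer than [j], so an oracle string of length [size d] already decides
    which selected items apply. *)
Lemma heavy_prefix d i r r' : size d <= size r -> prefix r r' ->
  heavy d i r' = heavy d i r.
Proof.
move=> hd hr; rewrite /heavy; congr (_ < cnt _ (covers _) * _).
congr map; apply: eq_in_filter => j; rewrite mem_iota /= add0n => hj.
congr [&& _, _, _ & _]; apply/idP/idP => h; last exact: prefix_trans h hr.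
have ht : size (tau j) <= size r by have := size_tau j; lia.
by move: h hr; rewrite !prefixE => /eqP e /eqP <-; rewrite take_takel // e.
Qed.

(** A finite set of outputs stems from finitely many items [J], so one finite selection that
    contains [J] and is not heavy bounds its measure. *)
Lemma light_outs (P : nat -> Prop) A i :
  (forall J : seq nat, (forall j, j \in J -> P j) ->
     exists d r, [/\ initial r A, size d <= size r, ~~ heavy d i r &
                     forall j, j \in J -> nth false d j]) ->
  light (lvl i) (outs (fun j => P j /\ initial (tau j) A) (idx i) (lvl i)).
Proof.
move=> H D N hD hN.
have /choice[f hf] : forall s, exists j, s \in D ->
    [/\ P j, initial (tau j) A, idx j = idx i, lvl j = lvl i & sig j = s].
  move=> s; have [/hD[j [[Pj tj] ij lj sj]]|] := pselect (s \in D).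
    by exists j.
  by exists 0.
have [|d [r [rA dr no hJ]]] := H (map f D).
  by move=> j /mapP[s /hf[Pj _ _ _ _] ->].
have hsub t : covers D t -> covers (sel d i r) t.
  apply: covers_sub => s sD; have [Pj tj ij lj sj] := hf s sD.
  have dj : nth false d (f s) by apply: hJ; apply: map_f.
  apply/selP; exists (f s); split=> //; rewrite rA prefix_initial; split=> //.
  exact: leq_trans (size_tau _) (leq_trans (ltnW (nth_size dj)) dr).
move: no; rewrite /heavy -leqNgt => no.
rewrite -(@leq_pmul2l (2 ^ size d)) ?expn_gt0 // mulnA -cnt_covers_scale //.
apply: leq_trans (_ : cnt (size d + N) (covers (sel d i r)) * 2 ^ lvl i <= _).
  by rewrite addnC leq_mul2r cnt_mono ?orbT // => t _; apply: hsub.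
rewrite cnt_covers_scale ?size_sel // -mulnA [leqRHS]mulnC.
by rewrite leq_pmul2l ?expn_gt0.
Qed.

Lemma light_not_heavy (P : nat -> Prop) A i d r :
  light (lvl i) (outs (fun j => P j /\ initial (tau j) A) (idx i) (lvl i)) ->
  initial r A -> (forall j, nth false d j -> P j) -> ~~ heavy d i r.
Proof.
move=> hl rA hd; rewrite /heavy -leqNgt; apply: hl (size_sel _ _ _).
move=> s /selP[j [/hd Pj ij lj tj sj]]; exists j; split=> //; split=> //.
by move: tj; rewrite rA prefix_initial => -[].
Qed.

Lemma geometric_bound (a : nat -> nat) b E n :
  (forall e, e < E -> a e * 2 ^ (n + e.+1) <= b) ->
  (\sum_(e < E) a e) * 2 ^ n <= b.
Proof.
elim: E a n => [|E IH] a n h; first by rewrite big_ord0.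
have h0 : a 0 * 2 ^ n.+1 <= b by have := h 0 isT; rewrite addn1.
have h1 : (\sum_(e < E) a e.+1) * 2 ^ n.+1 <= b.
  apply: (IH (fun e => a e.+1)) => e he.
  by have := h e.+1 he; rewrite [n + _]addnS -addSn.
rewrite big_ord_recl mulnDl; set S := \sum_(e < E) a (bump 0 e).
have eS : S = \sum_(e < E) a e.+1 by apply: eq_bigr.
by rewrite -eS in h1; rewrite expnS in h0 h1; rewrite /=; lia.
Qed.

Lemma light_union n (V : set string) (F : nat -> set string) :
  (forall s, V s -> exists e, F e s) ->
  (forall e, light (n + e.+1) (F e)) -> light n V.
Proof.
move=> hV hF D N hD hN.
have /choice[f hf] : forall s, exists e, s \in D -> F e s.
  move=> s; have [/hD/hV[e]|] := pselect (s \in D); first by exists e.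
  by exists 0.
pose De e := [seq s <- D | f s == e].
pose E := (\max_(s <- D) f s).+1.
have le : cnt N (covers D) <= \sum_(e < E) cnt N (covers (De e)).
  rewrite -(big_mkord xpredT (fun e => cnt N (covers (De e)))).
  apply: leq_trans (cnt_has _ _ _); apply: cnt_mono => t _ /hasP[s sD st].
  apply/hasP; exists (f s).
    by rewrite mem_index_iota /= ltnS; apply: leq_bigmax_seq.
  by apply/hasP; exists s; rewrite // mem_filter eqxx.
apply: leq_trans (_ : (\sum_(e < E) cnt N (covers (De e))) * 2 ^ n <= _).
  by rewrite leq_mul2r le orbT.
apply: (@geometric_bound (fun e => cnt N (covers (De e)))) => e _; apply: hF.
  by move=> s; rewrite mem_filter => /andP[/eqP <-]; apply: hf.
by apply/allP => s; rewrite mem_filter => /andP[_ /(allP hN)].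
Qed.

(** Each accepted item comes with a stage [P] that is light at its level. For finitely many accepted
    items of the same level and index, the largest of their stages contains them all. *)
Lemma light_chain (C : set (nat -> Prop)) A (Z : nat -> Prop) e m :
  (forall P Q, C P -> C Q -> (forall j, P j -> Q j) \/ (forall j, Q j -> P j)) ->
  (forall i, Z i -> initial (tau i) A /\ exists P, [/\ C P, P i &
     light (lvl i) (outs (fun j => P j /\ initial (tau j) A) (idx i) (lvl i))]) ->
  light m (outs Z e m).
Proof.
move=> hC hZ D N hD hN.
have [->|[P [_ hP hDP]]] : D = [::] \/ exists P, [/\ C P,
    light m (outs (fun j => P j /\ initial (tau j) A) e m) &
    forall s, s \in D -> outs (fun j => P j /\ initial (tau j) A) e m s].
- elim: D hD {hN} => [|s D IH] hD; first by left.
  right; have [i [Zi ie im si]] := hD s (mem_head _ _).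
  have [ti [P [CP Pi hP]]] := hZ i Zi; rewrite ie im in hP.
  have hs : outs (fun j => P j /\ initial (tau j) A) e m s by exists i.
  have [|->|[Q [CQ hQ hDQ]]] := IH; first by move=> u uD; apply: hD;
    rewrite inE uD orbT.
    by exists P; split=> // u; rewrite inE => /eqP ->.
  have [h|h] := hC P Q CP CQ.
  + exists Q; split=> // u; rewrite inE => /orP[/eqP ->|/hDQ//].
    by case: hs => j [[/h Qj tj] ? ? ?]; exists j.
  + exists P; split=> // u; rewrite inE => /orP[/eqP ->//|/hDQ].
    by move=> [j [[/h Pj tj] ? ? ?]]; exists j.
- by rewrite -[covers [::]]/(pred0 : pred string) cnt0.
- exact: hP.
Qed.

Lemma pr_cnt N (p : nat -> pred string) : primrec N ->
  primrec (fun z => p (pi1 z) (sdec (pi2 z))) -> primrec (fun x => cnt (N x) (p x)).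
Proof.
move=> hN hp.
have h : primrec (fun x => \sum_(c < 2 ^ N x) p x (sdec (2 ^ N x - 1 + c))).
  apply: (@pr_sum (fun x => 2 ^ N x) (fun x c => p x (sdec (2 ^ N x - 1 + c)))).
    by pr.
  have hN1 := pr_comp hN pr_pi1.
  by apply: (@pr_app2 (fun x c => p x (sdec c))) => //; pr.
by apply: pr_ext h => x; rewrite cnt_code.
Qed.

Lemma has_filter (T : Type) (a b : pred T) s :
  has a [seq x <- s | b x] = has (fun x => b x && a x) s.
Proof. by elim: s => //= x s <-; case: (b x). Qed.

Lemma pr_heavy D I P : primrec D -> primrec I -> primrec P ->
  primrec (fun x => heavy (sdec (D x)) (I x) (sdec (P x))).
Proof.
move=> hD hI hP.
have hc : primrec (fun x => cnt (size (sdec (D x)))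
    (covers (sel (sdec (D x)) (I x) (sdec (P x))))).
  apply: (@pr_cnt (fun x => size (sdec (D x)))
    (fun x => covers (sel (sdec (D x)) (I x) (sdec (P x))))); first by pr.
  have hD2 := pr_comp (pr_comp hD pr_pi1) pr_pi1.
  have hI2 := pr_comp (pr_comp hI pr_pi1) pr_pi1.
  have hP2 := pr_comp (pr_comp hP pr_pi1) pr_pi1.
  apply: (@pr_ext (fun z => has (fun j =>
    [&& nth false (sdec (D (pi1 z))) j, idx j == idx (I (pi1 z)),
        lvl j == lvl (I (pi1 z)) & prefix (tau j) (sdec (P (pi1 z)))] &&
    prefix (sig j) (sdec (pi2 z))) (iota 0 (size (sdec (D (pi1 z))))))).
    by move=> z; rewrite /covers /sel has_map has_filter.
  have hD1 := pr_comp hD pr_pi1.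
  apply: (@pr_has _ (fun z j =>
    [&& nth false (sdec (D (pi1 z))) j, idx j == idx (I (pi1 z)),
        lvl j == lvl (I (pi1 z)) & prefix (tau j) (sdec (P (pi1 z)))] &&
    prefix (sig j) (sdec (pi2 z)))); first by pr.
  by rewrite /idx /lvl /tau /sig; pr.
by rewrite /heavy /lvl; pr.
Qed.

Lemma pi_ex_string (P : (nat -> nat) -> nat -> string -> Prop) :
  Pi (fun f z => P f (pi1 z) (sdec (pi2 z))) ->
  Pi (fun f x => exists d : string, P f x d).
Proof.
move=> /(@pi_ex (fun f x n => P f x (sdec n))); apply: pi_iff => f x.
split=> [[n h]|[d h]]; first by exists (sdec n).
by exists (scode d); rewrite scodeK.
Qed.

Lemma pi_all_string (P : (nat -> nat) -> nat -> string -> Prop) :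
  Pi (fun f z => P f (pi1 z) (sdec (pi2 z))) ->
  Pi (fun f x => forall d : string, P f x d).
Proof.
move=> /(@pi_all (fun f x n => P f x (sdec n))); apply: pi_iff => f x.
by split=> [h d|h n]; [rewrite -(scodeK d)|].
Qed.

(** * Universal tests from trimmed enumerations *)

Section Universal.
Variables (R : realType) (A : cantor).

Definition enumerated (Z : string -> nat -> Prop) (i : nat) : Prop :=
  exists r, initial r A /\ Z r i.

(** Here [Z r i] means that item [i] is accepted on seeing [r]. Trimming makes every level light and
    loses nothing from a level that was light already, so genuine tests survive intact. *)
Lemma universal_of_trimming (Z : string -> nat -> Prop) :
  Pi (fun _ z => Z (sdec (pi1 z)) (pi2 z)) ->
  (forall e m, light m (outs (enumerated Z) e m)) ->
  (forall i, univ i -> initial (tau i) A ->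
     light (lvl i) (outs (fun j => univ j /\ initial (tau j) A) (idx i) (lvl i)) ->
     enumerated Z i) ->
  exists V, universal_test_rel R A V.
Proof.
move=> hZ hl hu.
(* Index [e] contributes its level [n + e.+1], and these bounds sum to at most [2 ^- n]. *)
pose W : set (nat * string * string) := [set w | exists i,
  [/\ sig i = w.2, lvl i = w.1.1 + (idx i).+1 & Z w.1.2 i]].
have hW : Pi11 code_nss W.
  have /Pi_formula[p hp] : Pi (fun _ x => exists i,
      ((pi1 (pi2 (pi2 (pi2 i))) == pi2 (pi2 x)) &&
       (lvl i == pi1 x + (idx i).+1)) /\ Z (sdec (pi1 (pi2 x))) i).
    apply: pi_ex; apply: pi_and.
      by apply: pi_bool; rewrite /lvl /idx; pr.
    have := pi_comp hZ (pr_pair (pr_comp pr_pi1 (pr_comp pr_pi2 pr_pi1)) pr_pi2).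
    by apply: pi_iff => _ x; rewrite !pairE.
  exists p => -[[n t] s]; rewrite -hp /= !pairE scodeK; split.
    move=> [i [/= <- e h]]; exists i; split=> //.
    by rewrite /sig sdecK eqxx e eqxx.
  move=> [i [/andP[/eqP e1 /eqP e2] h]]; exists i; split=> //.
  by rewrite /sig e1 scodeK.
exists (fun n => open_of (section [set ts | W (n, ts.1, ts.2)] A)); split.
  split; first by exists W.
  move=> n; apply: coin_le.
  apply: (@light_union _ _ (fun e => outs (enumerated Z) e (n + e.+1))).
    move=> s [t tA [i [/= si li hi]]]; exists (idx i), i; split=> //.
    by exists t.
  by move=> e; apply: hl.
move=> X; rewrite /higher_ML_random_rel => /existsNP[U /not_implyP[]].
move=> [[W' /Pi11_nss_index[e he] hU] hcoin] /contrapT hX n _ /=.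
pose m := n + e.+1.
have lm : light m (section [set ts | W' (m, ts.1, ts.2)] A).
  by apply: (@coin_light R); rewrite -hU.
have := hX m I; rewrite hU => -[s sX [t tA /= /he wi]]; exists s => //.
have [||r [rA hr]] := hu _ wi; first by rewrite tau_item.
  rewrite idx_item lvl_item; apply: light_sub lm => u [i [[ui ti] ie li ui']].
  by exists (tau i) => //=; rewrite he -ie -li -ui' item_eta.
exists r => //; exists (item e m t s).
by rewrite sig_item lvl_item idx_item.
Qed.

(* The relation [Q], used along [A], yields an increasing sequence of finite
   subsets of [univ] with union [univ]. The finite stages of this enumeration
   can be tested one by one for measure. *)
Lemma universal_of_approximation (Q : string -> string -> Prop) :
  Pi (fun _ z => Q (sdec (pi1 z)) (sdec (pi2 z))) ->
  (forall r d, Q r d -> size d <= size r) ->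
  (forall r d j, initial r A -> Q r d -> nth false d j -> univ j) ->
  (forall r d r' d', initial r A -> initial r' A -> Q r d -> Q r' d' ->
     (forall j, nth false d j -> nth false d' j) \/
     (forall j, nth false d' j -> nth false d j)) ->
  (forall j, univ j -> exists r d, [/\ initial r A, Q r d & nth false d j]) ->
  exists V, universal_test_rel R A V.
Proof.
move=> hQ hsize hsound hchain hcomplete.
(* An item is accepted when some stage [d] contains it without being heavy; [r] is long enough to
   decide this. *)
pose Z (r : string) (i : nat) := exists d : string, [/\ Q r d,
  nth false d i, prefix (tau i) r & ~~ heavy d i r].
apply: (@universal_of_trimming Z).
- have h : Pi (fun _ z => exists d : string, Q (sdec (pi1 z)) d /\
      [&& nth false d (pi2 z), prefix (tau (pi2 z)) (sdec (pi1 z)) &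
          ~~ heavy d (pi2 z) (sdec (pi1 z))]).
    apply: pi_ex_string; apply: pi_and.
      have := pi_comp hQ (pr_pair (pr_comp pr_pi1 pr_pi1) pr_pi2).
      by apply: pi_iff => _ x; rewrite !pairE.
    by apply: pi_bool; rewrite /tau; pr; apply: pr_heavy; pr.
  apply: pi_iff h => _ z; split.
    by move=> [d [q /and3P[? ? ?]]]; exists d; split.
  by move=> [d [q h1 h2 h3]]; exists d; split=> //; apply/and3P.
- move=> e m.
  apply: (@light_chain [set P | exists r d, [/\ initial r A, Q r d &
    P = (fun j => nth false d j : Prop)]] A).
    move=> P P' [r [d [rA q ->]]] [r' [d' [rA' q' ->]]].
    exact: hchain rA rA' q q'.
  move=> i [r [rA [d [q di ti no]]]]; split.
    by move: ti; rewrite {1}rA prefix_initial => -[].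
  exists (fun j => nth false d j); split=> //; first by exists r, d.
  apply: light_outs => J hJ; exists d, r; split=> //.
  exact: hsize q.
- move=> i ui ti hl; have [r [d [rA q di]]] := hcomplete i ui.
  exists r; split=> //; exists d; split=> //.
    rewrite rA prefix_initial; split=> //.
    apply: leq_trans (size_tau i) _.
    exact: leq_trans (ltnW (nth_size di)) (hsize _ _ q).
  exact: (light_not_heavy hl rA (fun j => hsound r d j rA q)).
Qed.
End Universal.

(** * Oracles computing O and tree-collapsing oracles *)

Section Cases.
Variables (R : realType) (A : cantor).

Lemma initial_sub r r' : initial r A -> initial r' A ->
  size r <= size r' -> prefix r r'.
Proof. by move=> rA rA' h; rewrite rA' prefix_initial. Qed.

Lemma prefix_initial_trans t r : initial r A -> prefix t r -> initial t A.
Proof. by move=> {1}->; rewrite prefix_initial => -[]. Qed.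

Lemma universal_of_kleeneO : higher_computes A seqO ->
  exists V, universal_test_rel R A V.
Proof.
move=> [F /Pi11_index[a ha] [_ hF]].
have [h [prh hh]] := kleeneO_complete.
(* Only non-membership is read off the functional; membership in [univ] is Pi^1_1 anyway. So
   correctness of a segment [d] of [univ], certified by a segment [r] of the oracle, is Pi^1_1. *)
have F_neg j : (exists2 s, section F A s &
    h j < size s /\ nth false s (h j) = false) <-> ~ univ j.
  by rewrite -hF hh /seqO; case: asboolP => k; split.
pose Q (r d : string) := size d <= size r /\ forall j, j < size d ->
  (nth false d j -> univ j) /\
  (~~ nth false d j -> exists t s : string, F (t, s) /\
     [&& prefix t r, h j < size s & ~~ nth false s (h j)]).
have sound r d j : initial r A -> Q r d -> j < size d ->
    nth false d j <-> univ j.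
  move=> rA [_ /(_ j) hd] /hd[h1 h2]; split=> //.
  move=> uj; apply: contrapT => /negP/h2[t [s [Fts /and3P[tr hs ns]]]].
  apply: (proj1 (F_neg j) _ uj); exists s; last by split=> //; apply: negbTE.
  by exists t => //; exact: (prefix_initial_trans rA tr).
apply: (@universal_of_approximation R A Q).
- have hp : Pi (fun _ z => size (sdec (pi2 z)) <= size (sdec (pi1 z)) /\
      forall j, j < size (sdec (pi2 z)) ->
      (nth false (sdec (pi2 z)) j -> univ j) /\
      (nth false (sdec (pi2 z)) j \/ exists t s : string,
         univ (pair_nat a (pair_nat (scode t) (pair_nat (scode s) 0))) /\
         [&& prefix t (sdec (pi1 z)), h j < size s & ~~ nth false s (h j)])).
    apply: pi_and; first by apply: pi_bool; pr.
    apply: pi_all; apply: pi_imp; first by pr.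
    apply: pi_and; first by apply: pi_imp; [pr|apply: pi_univ; pr].
    apply: pi_or; first by apply: pi_bool; pr.
    apply: pi_ex_string; apply: pi_ex_string; apply: pi_and.
      have hu : Pi (fun _ z => univ (pair_nat a (pair_nat (pi2 (pi1 z))
          (pair_nat (pi2 z) 0)))) by apply: pi_univ; pr.
      by apply: pi_iff hu => _ z; rewrite !sdecK.
    have prh3 := pr_comp prh (pr_comp pr_pi2 (pr_comp pr_pi1 pr_pi1)).
    by apply: pi_bool; pr.
  apply: pi_iff hp => _ z; rewrite /Q.
  split=> -[h1 h2]; split=> // j /h2[h3 h4]; split=> //.
  + move=> nd; case: h4 => [dj|[t [s [u e]]]]; first by rewrite dj in nd.
    by exists t, s; split=> //; rewrite ha.
  + have [|/h4[t [s [u e]]]] := boolP (nth false _ j); first by left.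
    by right; exists t, s; split=> //; move: u; rewrite ha.
- by move=> r d [].
- by move=> r d j rA q dj; apply/(sound r d j rA q (nth_size dj)).
- move=> r d r' d' rA rA' q q'.
  have [hd|/ltnW hd] := leqP (size d) (size d'); [left|right] => j dj.
    have hj := nth_size dj; apply/(sound _ _ _ rA' q' (leq_trans hj hd)).
    exact/(sound _ _ _ rA q hj).
  have hj := nth_size dj; apply/(sound _ _ _ rA q (leq_trans hj hd)).
  exact/(sound _ _ _ rA' q' hj).
- move=> j uj; pose d := mkseq (fun k => `[< univ k >]) j.+1.
  (* [g k] bounds the use of the oracle in certifying that [k] is not in [univ]. *)
  have /choice[g hg] : forall k, exists n, ~ univ k -> exists t s : string,
      F (t, s) /\ [&& prefix t (mkseq A n), h k < size s & ~~ nth false s (h k)].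
    move=> k; have [uk|nk] := pselect (univ k); first by exists 0.
    have [s [t tA Fts] [hs ns]] := proj2 (F_neg k) nk.
    exists (size t) => _; exists t, s; split=> //.
    by rewrite -tA prefix_refl hs ns.
  pose n := j.+1 + \sum_(k < j.+1) g k.
  exists (mkseq A n), d; split; first exact: initialP.
    split; first by rewrite !size_mkseq leq_addr.
    rewrite size_mkseq => k hk; rewrite nth_mkseq //.
    split=> [/asboolP//|/asboolPn/hg[t [s [Fts /and3P[tA hs ns]]]]].
    exists t, s; split=> //; apply/and3P; split=> //.
    apply: prefix_trans tA _; rewrite prefix_initial size_mkseq.
    split; first exact: initialP.
    by rewrite /n (bigD1 (Ordinal hk)) //=; lia.
  by rewrite nth_mkseq //; apply/asboolP.
Qed.

Lemma universal_of_tree_collapsing : tree_collapsing A ->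
  exists V, universal_test_rel R A V.
Proof.
move=> [T [_ /Pi11_index[a ha] AT hS]].
pose it (t : string) := pair_nat a (pair_nat (scode t) 0).
have uit t : initial t A -> univ (it t) by move=> /AT/ha.
(* Along [A], [d] lists the numbers enumerated no later than some prefix of [r] enters [T]. Then
   [it t] is in [univ], so [stage_lt] correctly expresses the negative answers. *)
pose Q (r d : string) := size d = size r /\ forall j, j < size d ->
  (nth false d j -> exists t : string, prefix t r /\ stage_le j (it t)) /\
  (~~ nth false d j -> forall t : string, prefix t r -> stage_lt (it t) j).
have sound r d j : initial r A -> Q r d -> j < size d ->
    nth false d j <-> exists t : string, prefix t r /\ stage_le j (it t).
  move=> rA [_ /(_ j) hd] /hd[h1 h2]; split=> // -[t [tr jt]].
  apply: contrapT => /negP/h2/(_ t tr) lt.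
  have ut := uit t (prefix_initial_trans rA tr).
  by apply: (proj2 (not_stage_le _) lt) => //; right.
have sub r d r' d' : initial r A -> initial r' A -> Q r d -> Q r' d' ->
    size r <= size r' -> forall j, nth false d j -> nth false d' j.
  move=> rA rA' q q' rr' j dj; have hj := nth_size dj.
  have [t [tr jt]] := proj1 (sound _ _ _ rA q hj) dj.
  have hj' : j < size d' by rewrite q'.1 -q.1 in rr' *; exact: leq_trans hj rr'.
  apply/(sound _ _ _ rA' q' hj'); exists t; split=> //.
  exact: prefix_trans tr (initial_sub rA rA' rr').
have prit F : primrec F ->
    primrec (fun x => pair_nat a (pair_nat (F x) 0)) by move=> hF; pr.
apply: (@universal_of_approximation R A Q).
- have hp : Pi (fun _ z => size (sdec (pi2 z)) == size (sdec (pi1 z)) /\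
      forall j, j < size (sdec (pi2 z)) ->
      (nth false (sdec (pi2 z)) j -> exists t : string,
         prefix t (sdec (pi1 z)) /\ stage_le j (it t)) /\
      (~~ nth false (sdec (pi2 z)) j -> forall t : string,
         prefix t (sdec (pi1 z)) -> stage_lt (it t) j)).
    apply: pi_and; first by apply: pi_bool; pr.
    apply: pi_all; apply: pi_imp; first by pr.
    apply: pi_and; apply: pi_imp; try by pr.
      apply: pi_ex_string; apply: pi_and; first by apply: pi_bool; pr.
      have hc : Pi (fun _ z => stage_le (pi2 (pi1 z))
          (pair_nat a (pair_nat (pi2 z) 0))) by apply: pi_stage_le; pr.
      by apply: pi_iff hc => _ z; rewrite /it sdecK.
    apply: pi_all_string; apply: pi_imp; first by pr.
    have hc : Pi (fun _ z => stage_lt (pair_nat a (pair_nat (pi2 z) 0))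
        (pi2 (pi1 z))) by apply: pi_stage_lt; pr.
    by apply: pi_iff hc => _ z; rewrite /it sdecK.
  by apply: pi_iff hp => _ z; split=> -[/eqP h1 h2]; split=> //; apply/eqP.
- by move=> r d [->].
- move=> r d j rA q dj.
  have [t [_ /stage_le_univ]] := proj1 (sound _ _ _ rA q (nth_size dj)) dj.
  exact.
- move=> r d r' d' rA rA' q q'.
  by have [h|/ltnW h] := leqP (size r) (size r'); [left|right];
    apply: sub h.
- move=> j uj.
  (* Otherwise all prefixes of [A] enter [T] before stage [j], and the strings all of whose prefixes
     have entered by then form the forbidden subtree [S]. *)
  have [k jk] : exists k, stage_le j (it (mkseq A k)).
    apply: contrapT => /forallNP no.
    pose S : set string :=
      [set s | forall t : string, prefix t s -> stage_le (it t) j].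
    apply: (hS S).
    + by move=> s t st hs u us; apply: hs; apply: prefix_trans us st.
    (* As [j] is in [univ], the negation of [stage_le (it t) j] is [stage_lt j (it t)]; this makes
       the complement of [S] Pi^1_1 as well. *)
    + split.
        have /Pi_formula[p hp] : Pi (fun _ x => forall t : string,
            prefix t (sdec (pi1 x)) -> stage_le (it t) j).
          apply: pi_all_string; apply: pi_imp; first by pr.
          have hc : Pi (fun _ z => stage_le (pair_nat a (pair_nat (pi2 z) 0)) j).
            by apply: pi_stage_le; pr.
          by apply: pi_iff hc => _ z; rewrite /it sdecK.
        by exists p => s; rewrite -hp /= !pairE scodeK.
      have /Pi_formula[p hp] : Pi (fun _ x => exists t : string,
          prefix t (sdec (pi1 x)) /\ stage_lt j (it t)).
        apply: pi_ex_string; apply: pi_and; first by apply: pi_bool; pr.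
        have hc : Pi (fun _ z => stage_lt j (pair_nat a (pair_nat (pi2 z) 0))).
          by apply: pi_stage_lt; pr.
        by apply: pi_iff hc => _ z; rewrite /it sdecK.
      exists p => s; rewrite -hp /= !pairE scodeK.
      rewrite /S /= -existsNE; split.
        move=> [t /not_implyP[ts nt]]; exists t; split=> //.
        by apply/not_stage_le; first by right.
      move=> [t [ts lt]]; exists t; apply/not_implyP; split=> //.
      by apply/not_stage_le; first by right.
    + move=> s /(_ s (prefix_refl s)) /stage_le_univ.
      by rewrite /it -[pair_nat (scode s) 0]/(ecode (code_s s)) -ha.
    + move=> s sA t ts; have tA := prefix_initial_trans sA ts.
      by apply: stage_lt_le; apply/not_stage_le; [left|rewrite tA; apply: no].
  pose n := maxn k j.+1; pose r := mkseq A n.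
  have rA : initial r A by exact: initialP.
  pose d := mkseq (fun i => `[< exists t : string,
    prefix t r /\ stage_le i (it t) >]) n.
  exists r, d; split=> //; last first.
    rewrite nth_mkseq ?leq_max ?leqnn ?orbT //; apply/asboolP.
    exists (mkseq A k); split=> //.
    by rewrite prefix_initial size_mkseq leq_maxl; split=> //; apply: initialP.
  split; first by rewrite !size_mkseq.
  rewrite size_mkseq => i hi; rewrite nth_mkseq //.
  split=> [/asboolP//|/asboolPn no t tr].
  apply/not_stage_le; first by right; apply: uit (prefix_initial_trans rA tr).
  by move=> it'; apply: no; exists t.
Qed.

End Cases.

(** * Random oracles *)

(** For [i] in [univ] this singles out [stage_string i (size d)]; stating the negative answers by
    [stage_lt] keeps the relation Pi^1_1. *)
Definition correct (d : string) (i : nat) : Prop := forall j, j < size d ->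
  (nth false d j -> stage_le j i) /\ (~~ nth false d j -> stage_lt i j).

Definition stage_string (i k : nat) : string :=
  mkseq (fun j => `[< stage_le j i >]) k.

Lemma stage_string_correct i k : univ i -> correct (stage_string i k) i.
Proof.
move=> ui j; rewrite size_mkseq => hj; rewrite nth_mkseq //.
split=> [/asboolP//|/asboolPn h].
by apply/not_stage_le; first by right.
Qed.

Lemma correct_unique i d : univ i -> correct d i -> d = stage_string i (size d).
Proof.
move=> ui hd; apply: (@eq_from_nth _ false); first by rewrite size_mkseq.
move=> j hj; rewrite nth_mkseq //; have [h1 h2] := hd j hj.
apply/idP/asboolP => [/h1//|le]; apply: contrapT => /negP/h2 lt.
by apply: (proj2 (not_stage_le _) lt) => //; right.
Qed.

Lemma stage_string_mono i k k' r r' : k <= k' -> prefix r r' ->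
  heavy (stage_string i k) i r -> heavy (stage_string i k') i r'.
Proof.
move=> kk'; apply: heavy_mono; first by rewrite !size_mkseq.
move=> j dj; have := nth_size dj; rewrite size_mkseq => hj.
by move: dj; rewrite !nth_mkseq //; apply: leq_trans hj kk'.
Qed.

Definition jump (d d' : string) (i : nat) : nat :=
  cnt (size d') (fun r => heavy d' i r && ~~ heavy d i r).

(* From length [k] on, the measure of the set of oracles for which the item [i]
   is found to be too large increases by at most [2 ^- (c + i.+1)]. *)
Definition settled (c i k : nat) : Prop := forall k', k <= k' ->
  exists d d' : string, [/\ size d = k, size d' = k', correct d i, correct d' i &
    jump d d' i * 2 ^ (c + i.+1) <= 2 ^ k'].

(** The existential form of [settled] makes it visibly Pi^1_1; for [i] in [univ] its witnesses are
    unique. *)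
Lemma settledE c i k : univ i -> settled c i k <->
  forall k', k <= k' ->
    jump (stage_string i k) (stage_string i k') i * 2 ^ (c + i.+1) <= 2 ^ k'.
Proof.
move=> ui; split=> h k' kk'.
  have [d [d' [dk dk' cd cd' H]]] := h k' kk'.
  by rewrite -dk -(correct_unique ui cd) -dk' -(correct_unique ui cd') dk'.
exists (stage_string i k), (stage_string i k'); rewrite !size_mkseq; split=> //.
- exact: stage_string_correct.
- exact: stage_string_correct.
- exact: h.
Qed.

Lemma cnt_diff N (p q : pred string) :
  (forall t, size t = N -> q t -> p t) ->
  cnt N p = cnt N (fun t => p t && ~~ q t) + cnt N q.
Proof.
move=> h; rewrite -cnt_disjointU; last first.
  by move=> t _; case: (p t); case: (q t).
apply: eq_cnt => t /h; case: (q t); last by rewrite andbT orbF.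
by move=> ->; rewrite ?orbT.
Qed.

(** Each failure to be settled raises the measure of the oracles with heavy [i] by more than
    [2 ^- (c + i.+1)]; as this measure is at most 1, more than [2 ^ (c + i.+1)] successive failures
    are impossible. *)
Lemma settled_exists c i k0 : univ i -> exists k, k0 <= k /\ settled c i k.
Proof.
move=> ui; apply: contrapT => /forallNP no.
pose u k := cnt k (heavy (stage_string i k) i).
have H n : exists k, k0 <= k /\ n * 2 ^ k <= u k * 2 ^ (c + i.+1).
  elim: n => [|n [k [k0k hk]]]; first by exists k0.
  have : ~ settled c i k by move=> h; apply: (no k).
  rewrite settledE // => /existsNP[k' /not_implyP[kk' /negP]].
  rewrite -ltnNge => hj; exists k'; split; first exact: leq_trans k0k kk'.
  have -> : u k' = jump (stage_string i k) (stage_string i k') i +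
                   2 ^ (k' - k) * u k.
    rewrite /u /jump size_mkseq -cnt_take subnKC //.
    rewrite (@cnt_diff _ (heavy (stage_string i k') i)
      (fun t => heavy (stage_string i k) i (take k t))); last first.
      by move=> t _; apply: stage_string_mono kk' (prefix_take _ _).
    congr addn; apply: eq_cnt => t ht; congr (_ && ~~ _).
    rewrite (@heavy_prefix _ _ (take k t)) ?prefix_take //.
    by rewrite size_mkseq size_takel // ht.
  rewrite mulSn mulnDl leq_add //; first exact: ltnW.
  rewrite -{1}(subnKC kk') expnD mulnA mulnC -[leqRHS]mulnA.
  by rewrite leq_mul2l hk orbT.
have [k [_]] := H (2 ^ (c + i.+1)).+1; apply/negP; rewrite -ltnNge.
apply: leq_ltn_trans (_ : 2 ^ k * 2 ^ (c + i.+1) < _).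
  by rewrite leq_mul2r cnt_le_max orbT.
by rewrite mulSn mulnC -[X in X < _]add0n ltn_add2r expn_gt0.
Qed.

Definition escape_item (c i : nat) (r : string) : Prop :=
  exists k, [/\ univ i, settled c i k, k <= size r &
    exists d d' : string, [/\ size d = k, size d' = size r, correct d i,
      correct d' i & heavy d' i r && ~~ heavy d i r]].

Definition escape (c : nat) : set string := [set r | exists i, escape_item c i r].

(** Heaviness is monotone in the length, so errors made at any settled length are also errors at the
    least settled length [k]. The bound for [k] then covers all of them at once. *)
Lemma light_escape_item c i : light (c + i.+1) [set r | escape_item c i r].
Proof.
move=> D N hD hN.
have [->|[r0 r0D]] : D = [::] \/ exists r, r \in D.
- by case: D {hD hN} => [|r D]; [left|right; exists r; rewrite mem_head].
- by rewrite -[covers [::]]/(pred0 : pred string) cnt0.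
have ui : univ i by have [k []] := hD _ r0D.
have ex : exists k, `[< settled c i k >].
  by have [k [_ h _ _]] := hD _ r0D; exists k; apply/asboolP.
have [k /asboolP hk kmin] := ex_minnP ex.
have kN : k <= N.
  have [k' [_ h kr _]] := hD _ r0D.
  apply: leq_trans (kmin k' _) _; first exact/asboolP.
  exact: leq_trans kr (allP hN _ r0D).
have := (proj1 (settledE _ _ ui) hk) N kN.
apply: leq_trans; rewrite leq_mul2r /jump size_mkseq; apply/orP; right.
apply: cnt_mono => t ht /hasP[r rD rt].
have [k' [_ hk' kr [d [d' [dk dk' cd cd' /andP[hv nh]]]]]] := hD _ rD.
rewrite (correct_unique ui cd') dk' in hv.
rewrite (correct_unique ui cd) dk in nh.
apply/andP; split.
  by apply: stage_string_mono rt hv; apply: (allP hN).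
apply: contra nh => h.
have kk' : k <= k' by apply: kmin; apply/asboolP.
have := stage_string_mono kk' (prefix_refl t) h.
by rewrite (@heavy_prefix _ _ r) // size_mkseq.
Qed.

Lemma light_escape c : light c (escape c).
Proof.
apply: (@light_union c _ (fun i => [set r | escape_item c i r])) => // i.
exact: light_escape_item.
Qed.

Lemma pi_correct D F : primrec D -> primrec F ->
  Pi (fun _ x => correct (sdec (D x)) (F x)).
Proof.
move=> hD hF; have hD1 := pr_comp hD pr_pi1; have hF1 := pr_comp hF pr_pi1.
apply: pi_all; apply: pi_imp; first by pr.
apply: pi_and; apply: pi_imp; try by pr.
  by apply: pi_stage_le; pr.
by apply: pi_stage_lt; pr.
Qed.

Lemma pr_jump D D' F : primrec D -> primrec D' -> primrec F ->
  primrec (fun x => jump (sdec (D x)) (sdec (D' x)) (F x)).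
Proof.
move=> hD hD' hF; have hD1 := pr_comp hD pr_pi1.
have hD1' := pr_comp hD' pr_pi1; have hF1 := pr_comp hF pr_pi1.
apply: (@pr_cnt (fun x => size (sdec (D' x))) (fun x r =>
  heavy (sdec (D' x)) (F x) r && ~~ heavy (sdec (D x)) (F x) r)); first by pr.
by pr; apply: pr_heavy; pr.
Qed.

Lemma pi_settled C F K : primrec C -> primrec F -> primrec K ->
  Pi (fun _ x => settled (C x) (F x) (K x)).
Proof.
move=> hC hF hK.
have h : Pi (fun _ x => forall k', K x <= k' -> exists d d' : string,
    ((size d == K x) && (size d' == k') &&
     (jump d d' (F x) * 2 ^ (C x + (F x).+1) <= 2 ^ k')) /\
    (correct d (F x) /\ correct d' (F x))).
  have hK1 := pr_comp hK pr_pi1;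
    have hF3 := pr_comp hF (pr_comp pr_pi1 (pr_comp pr_pi1 pr_pi1)).
  have hC3 := pr_comp hC (pr_comp pr_pi1 (pr_comp pr_pi1 pr_pi1)).
  have hK3 := pr_comp hK (pr_comp pr_pi1 (pr_comp pr_pi1 pr_pi1)).
  apply: pi_all; apply: pi_imp; first by pr.
  apply: pi_ex_string; apply: pi_ex_string; apply: pi_and.
    by apply: pi_bool; pr; apply: pr_jump; pr.
  by apply: pi_and; apply: pi_correct; pr.
apply: pi_iff h => _ x; split=> h k' /h[d [d']].
  by move=> [/andP[/andP[/eqP h1 /eqP h2] h3] [h4 h5]]; exists d, d'.
by move=> [h1 h2 h3 h4 h5]; exists d, d'; rewrite h1 h2 h5 !eqxx.
Qed.

Lemma Pi11_escape : Pi11 code_ns [set x | escape x.1 x.2].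
Proof.
have /Pi_formula[p hp] : Pi (fun _ x => exists i k,
    univ i /\ (settled (pi1 x) i k /\ exists d d' : string,
     ([&& k <= size (sdec (pi1 (pi2 x))), size d == k,
          size d' == size (sdec (pi1 (pi2 x))),
          heavy d' i (sdec (pi1 (pi2 x))) & ~~ heavy d i (sdec (pi1 (pi2 x)))] /\
      (correct d i /\ correct d' i)))).
  apply: pi_ex; apply: pi_ex; apply: pi_and; first by apply: pi_univ; pr.
  apply: pi_and; first by apply: pi_settled; pr.
  apply: pi_ex_string; apply: pi_ex_string; apply: pi_and.
    by apply: pi_bool; pr; apply: pr_heavy; pr.
  by apply: pi_and; apply: pi_correct; pr.
exists p => -[c r]; rewrite -hp /= !pairE scodeK; split.
- move=> [i [k [ui hk kr [d [d' [h1 h2 h3 h4 /andP[h5 h6]]]]]]].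
  exists i, k; split=> //; split=> //; exists d, d'.
  by rewrite h1 h2 !eqxx kr h5 h6.
- move=> [i [k [ui [hk [d [d' [/and5P[kr /eqP h1 /eqP h2 h3 h4] [h5 h6]]]]]]]].
  exists i, k; split=> //; exists d, d'; split=> //.
  by rewrite h3 h4.
Qed.

Lemma universal_of_random (R : realType) (A : cantor) :
  higher_ML_random R A -> exists V, universal_test_rel R A V.
Proof.
move=> hA.
(* The sets [escape c] form a higher ML-test, which the random [A] passes. *)
have [c hc] : exists c, ~ open_of (escape c) A.
  apply: contrapT => /forallNP no.
  apply: (hA (fun c => open_of (escape c))).
    split; first by exists [set x | escape x.1 x.2]; [exact: Pi11_escape|].
    by move=> c; apply: coin_le; apply: light_escape.
  by move=> c _; apply: contrapT; apply: no.
(* The decision about [i] is made at the settled length [size r], by a Pi^1_1 condition. *)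
pose Z (r : string) (i : nat) := [/\ univ i, prefix (tau i) r,
  settled c i (size r) & exists d, [/\ size d = size r, correct d i & ~~ heavy d i r]].
apply: (@universal_of_trimming R A Z).
- have h : Pi (fun _ z => univ (pi2 z) /\ (prefix (tau (pi2 z)) (sdec (pi1 z)) /\
      (settled c (pi2 z) (size (sdec (pi1 z))) /\ exists d : string,
      ((size d == size (sdec (pi1 z))) && ~~ heavy d (pi2 z) (sdec (pi1 z)) /\
       correct d (pi2 z))))).
    apply: pi_and; first by apply: pi_univ; pr.
    apply: pi_and; first by apply: pi_bool; rewrite /tau; pr.
    apply: pi_and; first by apply: pi_settled; pr.
    apply: pi_ex_string; apply: pi_and; last by apply: pi_correct; pr.
    by apply: pi_bool; pr; apply: pr_heavy; pr.
  apply: pi_iff h => _ z; split.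
    move=> [h1 [h2 [h3 [d [/andP[/eqP h4 h5] h6]]]]]; split=> //.
    by exists d.
  move=> [h1 h2 h3 [d [h4 h5 h6]]]; do 3![split=> //]; exists d.
  by rewrite h4 eqxx h6.
- move=> e m.
  apply: (@light_chain [set P | exists i, univ i /\ P = stage_le^~ i] A).
    move=> P P' [i [ui ->]] [i' [ui' ->]].
    by have [h|h] := stage_le_total ui ui';
      [left|right] => j /stage_le_trans; apply.
  move=> i [r [rA [ui ti si [d [dr cd nh]]]]]; split.
    exact: prefix_initial_trans rA ti.
  exists (stage_le^~ i); split; [by exists i|exact: stage_le_refl|].
  apply: light_outs => J hJ.
  pose k := maxn (size r) (\max_(j <- J) j).+1.
  exists (stage_string i k), (mkseq A k); split.
  + exact: initialP.
  + by rewrite !size_mkseq.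
  (* If [i] became heavy at [A] after having been accepted at the settled length, [A] would lie in
     the open set of [escape c]. *)
  + apply/negP => hv; apply: hc; exists (mkseq A k); first exact: initialP.
    exists i, (size r); split=> //; first by rewrite size_mkseq leq_maxl.
    exists d, (stage_string i k); rewrite !size_mkseq; split=> //.
      exact: stage_string_correct.
    rewrite hv (@heavy_prefix _ _ r) // ?dr //.
    by rewrite prefix_initial leq_maxl.
  + move=> j jJ; rewrite nth_mkseq; first by apply/asboolP; apply: hJ.
    rewrite leq_max ltnS; apply/orP; right.
    exact: (@leq_bigmax_seq _ J xpredT id).
- move=> i ui ti hl; have [k [tk sk]] := settled_exists c (size (tau i)) ui.
  exists (mkseq A k); split; first exact: initialP.
  split=> //; rewrite ?size_mkseq //; first by rewrite prefix_initial.
  exists (stage_string i k); rewrite size_mkseq; split=> //.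
    exact: stage_string_correct.
  apply: (light_not_heavy hl (initialP A k)) => j dj.
  have := nth_size dj; rewrite size_mkseq => hj.
  by move: dj; rewrite nth_mkseq // => /asboolP/stage_le_univ.
Qed.

Theorem theorem6p1 (R : realType) (A : nat -> bool)
  (hA : higher_computes A seqO \/ tree_collapsing A \/ higher_ML_random R A) :
  exists V : nat -> set (nat -> bool), universal_test_rel R A V.
Proof.
case: hA => [|[]].
- exact: universal_of_kleeneO.
- exact: universal_of_tree_collapsing.
- exact: universal_of_random.
Qed.
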